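(* Let $\sigma$ be the endomorphism of the free group $F(a,b,c,d)$ defined by $\sigma(a)=aca$, $\sigma(b)=d$, $\sigma(c)=b$, $\sigma(d)=c$ (with $\sigma^0=\mathrm{id}$), and consider the presentation $$\Gamma=\langle\, a,b,c,d \ \|\ a^2,\ b^2,\ c^2,\ d^2,\ bcd,\ \sigma^i((ad)^4),\ \sigma^i((adacac)^4),\ i\ge 0\,\rangle .$$ There is a constant $C_1>1$ such that, for $j=0,1,2$, the Dehn $j$-function $f_{j,\Gamma}(x)$ of this presentation satisfies $f_{j,\Gamma}(x)\le C_1x^2\log_2 x$ for all integers $x\ge1$.
   Context: The displayed presentation is the Lysenok presentation of the Grigorchuk $2$-group of intermediate growth. Presentations. For a finite alphabet $\mathcal{A}$, let $\mathcal{A}^{\pm1}=\mathcal{A}\cup\mathcal{A}^{-1}$, $F(\mathcal{A})$ the free group over $\mathcal{A}$, and $|W|$ the length of a word $W$ over $\mathcal{A}^{\pm1}$. The relator set $\mathcal{R}$ (possibly infinite) of a presentation $\langle\mathcal{A}\,\|\,\mathcal{R}\rangle$ consists of nonempty cyclically reduced words over $\mathcal{A}^{\pm1}$; $\langle\langle\mathcal{R}\rangle\rangle$ is its normal closure in $F(\mathcal{A})$. A word $W$ over $\mathcal{A}^{\pm1}$ is said to be in $\langle\langle\mathcal{R}\rangle\rangle$ if the element of $F(\mathcal{A})$ it represents is. Van Kampen diagrams. $K(\mathcal{A},\mathcal{R})$ is the standard presentation 2-complex: one 0-cell, oriented 1-cells in bijection with the letters of $\mathcal{A}^{\pm1}$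 (a letter and its inverse corresponding to opposite orientations of one 1-cell), 2-cells in bijection with the words of $\mathcal{R}$, attached along these words. A van Kampen diagram over $\langle\mathcal{A}\,\|\,\mathcal{R}\rangle$ is a planar, finite, connected and simply connected 2-complex $\Delta$ with a continuous cellular map to $K(\mathcal{A},\mathcal{R})$ whose restriction to every (open) cell is a homeomorphism onto a cell. Thus each oriented edge $e$ carries a label $\varphi(e)\in\mathcal{A}^{\pm1}$ with $\varphi(e^{-1})=\varphi(e)^{-1}$, and the boundary of each 2-cell is labeled by a cyclic permutation of a word of $\mathcal{R}$ or its inverse. The label $\varphi(p)$ of a path $p=e_1\cdots e_k$ is $\varphi(e_1)\cdots\varphi(e_k)$. $\partial\Delta$ is the boundary path of $\Delta$, $\varphi(\partial\Delta)\equiv W$ means literal equality as cyclic words, and $|\Delta(j)|$ is the number of $j$-cells of $\Delta$. By van Kampen's lemma, $W\in\langle\langle\mathcal{R}\rangle\rangle$ if and only if there is a van Kampen diagram $\Delta$ with $\varphi(\partial\Delta)\equiv W$. Dehn $j$-functions. For $W\in\langle\langle\mathcal{R}\rangle\rangle$ and $j\in\{0,1,2\}$ let $L_j(W)=\min\{|\Delta(j)| : \varphi(\partial\Delta)\equiv W\}$, the minimum over van Kampen diagrams $\Delta$ over the presentation. The Dehn $j$-function is, for integers $x\ge1$, $f_j(x)=\max\{L_j(W) : W\in\langle\langle\mathcal{R}\rangle\rangle,\ |W|\le x\}$, where $W$ ranges over nonempty words and the maximum of the empty set is $0$. *)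

(* Defs.v *)
From HB Require Import structures.
From mathcomp Require Import all_boot all_order all_algebra fingroup perm.
From mathcomp Require Import classical_sets reals ereal exp.

Set Implicit Arguments.
Unset Strict Implicit.
Unset Printing Implicit Defensive.

Import Order.TTheory GRing.Theory Num.Theory.

(** * Words over [A^{±1}] and the free group *)

(* [(x, false)] is the letter x and [(x, true)] is its inverse. *)
Definition letter (A : Type) : Type := (A * bool)%type.
Definition word (A : Type) : Type := seq (letter A).

Definition letter_inv (A : Type) (l : letter A) : letter A := (l.1, ~~ l.2).

Definition word_inv (A : Type) (w : word A) : word A :=
  rev (map (@letter_inv A) w).

Definition word_pow (A : Type) (w : word A) (n : nat) : word A :=
  flatten (nseq n w).

(* Two words represent the same element of the free group F(A). *)
Inductive free_eq (A : Type) : word A -> word A -> Prop :=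
| free_eq_cancel (u v : word A) (l : letter A) :
    free_eq (u ++ l :: letter_inv l :: v) (u ++ v)
| free_eq_refl (u : word A) : free_eq u u
| free_eq_sym (u v : word A) : free_eq u v -> free_eq v u
| free_eq_trans (u v w : word A) :
    free_eq u v -> free_eq v w -> free_eq u w.

(* The words whose class in F(A) lies in <<Rel>>, the least normal subgroup
   of F(A) containing the classes of the words of Rel. *)
Inductive normal_closure (A : Type) (Rel : word A -> Prop) : word A -> Prop :=
| nc_rel (r : word A) : Rel r -> normal_closure Rel r
| nc_one : normal_closure Rel [::]
| nc_mul (u v : word A) :
    normal_closure Rel u -> normal_closure Rel v -> normal_closure Rel (u ++ v)
| nc_inv (u : word A) : normal_closure Rel u -> normal_closure Rel (word_inv u)
| nc_conj (u g : word A) :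
    normal_closure Rel u -> normal_closure Rel (g ++ u ++ word_inv g)
| nc_free (u v : word A) :
    free_eq u v -> normal_closure Rel u -> normal_closure Rel v.

Definition cyclic_eq (A : Type) (u v : word A) : Prop :=
  exists k : nat, v = rot k u.

(** * Van Kampen diagrams *)

(* A finite connected simply connected planar 2-complex is a finite connected
   graph embedded in the sphere, together with all of its complementary faces
   except one, the outer face.  Such an embedded graph is encoded by its
   rotation system.  Darts are the oriented edges, [vk_edge] reverses a dart,
   and [vk_face] sends a dart to the next one along the boundary of the face on
   its left.  [vk_edge x] and [vk_face x] both start where [x] ends, so the
   orbits of x |-> vk_face (vk_edge x) are the sets of darts issuing from a
   common vertex.  Euler's formula says that the surface is a sphere.  [vk_outer]
   is any dart having the outer face on its left.

   The complex reduced to one vertex, whose boundary label is the empty word,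
   has no dart and is not represented.  Darts are numbered, rather than taken in
   an arbitrary finType, to keep the type of diagrams in a small universe. *)
Definition vertex_perm (D : finType) (e f : {perm D}) : {perm D} := (e * f)%g.

Definition face_label (A : Type) (D : finType) (f : {perm D})
    (lab : D -> letter A) (x : D) : word A :=
  map lab (fingraph.orbit f x).

Record diagram (A : Type) (Rel : word A -> Prop) := Diagram {
  num_darts : nat;
  vk_edge : {perm 'I_num_darts};
  vk_face : {perm 'I_num_darts};
  vk_label : 'I_num_darts -> letter A;
  vk_outer : 'I_num_darts;
  vk_edgeK : forall x, vk_edge (vk_edge x) = x;
  vk_edge_neq : forall x, vk_edge x != x;
  vk_connected : forall x y,
    connect [rel u v | (v == vk_edge u) || (v == vk_face u)] x y;
  vk_planar :
    (#|porbits (vertex_perm vk_edge vk_face)| + #|porbits vk_face|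
     = #|porbits vk_edge| + 2)%N;
  vk_label_edge : forall x, vk_label (vk_edge x) = letter_inv (vk_label x);
  vk_label_face : forall x, x \notin porbit vk_face vk_outer ->
    exists2 r, Rel r &
      cyclic_eq r (face_label vk_face vk_label x) \/
      cyclic_eq (word_inv r) (face_label vk_face vk_label x)
}.

(* The boundary path is read with the diagram on the right of its darts; the
   opposite convention replaces each diagram by its mirror image, which has the
   same numbers of cells. *)
Definition boundary_label (A : Type) (Rel : word A -> Prop)
    (Delta : diagram Rel) (W : word A) : Prop :=
  cyclic_eq (face_label (@vk_face _ _ Delta) (@vk_label _ _ Delta)
                        (vk_outer Delta)) W.

Definition num_cells (A : Type) (Rel : word A -> Prop) (j : 'I_3)
    (Delta : diagram Rel) : nat :=
  match val j with
  | 0 => #|porbits (vertex_perm (vk_edge Delta) (vk_face Delta))|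
  | 1 => #|porbits (vk_edge Delta)|
  | _ => #|porbits (vk_face Delta)|.-1 (* the outer face is not a 2-cell *)
  end.

(** * Dehn j-functions *)

Local Open Scope classical_set_scope.
Local Open Scope ereal_scope.

(* The infimum of a nonempty set of natural numbers is its minimum; the value
   would be +oo if W bounded no diagram. *)
Definition min_cells (R : realType) (A : Type) (Rel : word A -> Prop)
    (j : 'I_3) (W : word A) : \bar R :=
  ereal_inf [set (num_cells j Delta)%:R%R%:E |
               Delta in [set Delta : diagram Rel | boundary_label Delta W]].

(* For a finite alphabet this is a supremum over finitely many words, hence a
   maximum; the extra element 0 gives the value 0 when there is no word W. *)
Definition dehn (R : realType) (A : finType) (Rel : word A -> Prop)
    (j : 'I_3) (x : nat) : \bar R :=
  ereal_sup (0 |` [set min_cells R Rel j W |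
               W in [set W : word A | [/\ normal_closure Rel W, W <> [::]
                                        & (size W <= x)%N]]]).

Local Close Scope ereal_scope.
Local Close Scope classical_set_scope.

(** * The Lysenok presentation *)

Inductive gen := ga | gb | gc | gd.

Definition gen_to_ord (g : gen) : 'I_4 :=
  match g with ga => inord 0 | gb => inord 1 | gc => inord 2 | gd => inord 3 end.

Definition ord_to_gen (i : 'I_4) : gen :=
  match val i with 0 => ga | 1 => gb | 2 => gc | _ => gd end.

Lemma gen_to_ordK : cancel gen_to_ord ord_to_gen.
Proof. by case; rewrite /ord_to_gen /= inordK. Qed.

HB.instance Definition _ := Finite.copy gen (can_type gen_to_ordK).

Definition wa : word gen := [:: (ga, false)].
Definition wb : word gen := [:: (gb, false)].
Definition wc : word gen := [:: (gc, false)].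
Definition wd : word gen := [:: (gd, false)].

Definition sigma_gen (g : gen) : word gen :=
  match g with
  | ga => wa ++ wc ++ wa
  | gb => wd
  | gc => wb
  | gd => wc
  end.

Definition sigma (w : word gen) : word gen :=
  flatten [seq if l.2 then word_inv (sigma_gen l.1) else sigma_gen l.1 | l <- w].

(* [sigma] maps positive words to positive words, so the words
   [iter i sigma _] below are cyclically reduced as they stand. *)
Inductive lysenok : word gen -> Prop :=
| lys_a : lysenok (word_pow wa 2)
| lys_b : lysenok (word_pow wb 2)
| lys_c : lysenok (word_pow wc 2)
| lys_d : lysenok (word_pow wd 2)
| lys_bcd : lysenok (wb ++ wc ++ wd)
| lys_ad (i : nat) : lysenok (iter i sigma (word_pow (wa ++ wd) 4))
| lys_adacac (i : nat) :
    lysenok (iter i sigma (word_pow (wa ++ wd ++ wa ++ wc ++ wa ++ wc) 4)).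

(* Main.v *)
Require Import Defs.
From mathcomp Require Import all_boot all_order all_algebra fingroup perm.
From mathcomp Require Import reals ereal exp.
From mathcomp Require Import zify.

(* A word acting trivially on the binary tree (in particular, a word of the
   normal closure) has an even number of a's, and its two sections W0, W1, each
   of about half its length, act trivially too.  As sigma(x) has sections
   (p(x), x) with p(x) in the dihedral group <a, d>, while D = ada has sections
   (b, 1), moving the occurrences of D to the left rewrites W, with O(|W|^2)
   relators of bounded length, as a product of conjugates of D followed by
   sigma(W1).  A conjugate of D by sigma(u) depends only on p(u), so the first
   factor is a sigma(V) a for a product V of conjugates of b by elements of
   <a, d>, and the same moves carry W0 to V p(W1), where p(W1) = 1.
   Trivialisations of W0 and W1 are thus transported by sigma, which replaces
   each relator by one twice as long: the total boundary length T(n) of the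
   relators satisfies T(n) <= 4 T(n/2) + O(n^2), whence n^2 log n.

   A diagram has at most as many cells of each dimension as darts, and darts
   are counted by these boundary lengths.  Diagrams only ever grow, by a spike or
   a chord drawn in the outer face; identifying two boundary edges is avoided by
   expanding a neighbouring letter instead, as in d -> adadada -> ... -> aad. *)

Set Implicit Arguments.
Unset Strict Implicit.
Unset Printing Implicit Defensive.

Import Order.TTheory GRing.Theory Num.Theory.

(** * Orbit counts of permutations under transport and insertion of a point *)

Lemma porbits_transport (T T' : finType) (h : T -> T') (s : {perm T})
    (s' : {perm T'}) :
  injective h -> (forall x, s' (h x) = h (s x)) ->
  porbits s' = (imset (fun X : {set T} => h @: X) (mem (porbits s)))
               :|: porbit s' @: ~: (h @: T).
Proof.
move=> h_inj hs.
have hX i x : (s' ^+ i)%g (h x) = h ((s ^+ i)%g x).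
  by elim: i => [|i IH]; rewrite ?expg0 ?perm1 // !expgSr !permM IH hs.
have hP x : porbit s' (h x) = h @: porbit s x.
  apply/setP=> y; apply/porbitP/imsetP => [[i ->]|[z /porbitP[i ->] ->]].
    by exists ((s ^+ i)%g x); rewrite ?mem_porbit ?hX.
  by exists i; rewrite hX.
apply/setP=> X; rewrite inE; apply/imsetP/orP.
  case=> y _ ->; case: (boolP (y \in h @: T)) => hy.
    case/imsetP: hy => x _ ->; left; rewrite hP.
    by apply/imsetP; exists (porbit s x) => //; apply: imset_f.
  by right; apply: imset_f; rewrite inE.
case=> /imsetP[y]; last by move=> _ ->; exists y.
by case/imsetP=> x _ -> ->; exists (h x) => //; rewrite hP.
Qed.

Lemma card_porbits_bij (T T' : finType) (h : T -> T') (s : {perm T})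
    (s' : {perm T'}) :
  bijective h -> (forall x, s' (h x) = h (s x)) ->
  #|porbits s'| = #|porbits s|.
Proof.
move=> h_bij hs; have h_inj := bij_inj h_bij.
rewrite (porbits_transport h_inj hs).
have -> : ~: (h @: T) = set0.
  apply/setP=> y; rewrite !inE; apply/negbTE; rewrite negbK.
  by case: h_bij => g _ gK; apply/imsetP; exists (g y).
by rewrite imset0 setU0 card_imset //; apply: imset_inj.
Qed.

Lemma card_porbits_le (T : finType) (s : {perm T}) : #|porbits s| <= #|T|.
Proof. exact: leq_imset_card. Qed.

Section Insertion.

Variable T : finType.

Lemma omap_perm_inj (s : {perm T}) : injective (omap s).
Proof. by move=> [x|] [y|] //= [] /perm_inj ->. Qed.

Definition ext (s : {perm T}) : {perm option T} := perm (@omap_perm_inj s).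

Lemma extS s x : ext s (Some x) = Some (s x). Proof. by rewrite permE. Qed.
Lemma extN s : ext s None = None. Proof. by rewrite permE. Qed.

(** Splices [None] into the cycle of [s] just after [x]; the product form gives access to the orbit
    count for a transposition. *)
Definition ins (s : {perm T}) (x : T) : {perm option T} :=
  (tperm None (Some x) * ext s)%g.

Lemma insN s x : ins s x None = Some (s x).
Proof. by rewrite permM tpermL extS. Qed.

Lemma insS s x z : ins s x (Some z) = if z == x then None else Some (s z).
Proof.
rewrite permM; case: eqP => [->|/eqP zx]; first by rewrite tpermR extN.
by rewrite tpermD ?extS //; apply: contra_neq zx => -[].
Qed.

Lemma card_porbits_ext s : #|porbits (ext s)| = #|porbits s|.+1.
Proof.
have Si : injective (@Some T) by move=> ? ? [].
rewrite (porbits_transport Si (extS s)).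
have -> : ~: (Some @: T) = [set None].
  apply/setP=> -[y|]; rewrite !inE; first by rewrite imset_f.
  by apply/negP=> /imsetP[].
rewrite imset_set1 setUC cardsU1 card_imset; last exact: imset_inj.
rewrite (_ : (_ \notin _) = true) //.
apply/imsetP=> -[X _ /setP/(_ None)]; rewrite porbit_id => /esym/imsetP.
by case.
Qed.

Lemma porbit_extN s y : (y \in porbit (ext s) None) = (y == None).
Proof.
apply/porbitP/eqP => [[i ->]|->]; last by exists 0; rewrite expg0 perm1.
by elim: i => [|i IH]; rewrite ?expg0 ?perm1 // expgSr permM IH extN.
Qed.

Lemma card_porbits_ins s x : #|porbits (ins s x)| = #|porbits s|.
Proof.
have /= := porbits_mul_tperm (ext s) None (Some x).
by rewrite porbit_sym porbit_extN card_porbits_ext -/(ins s x) /=; lia.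
Qed.

(** Splicing a dart fixed by [ext e] into a face also splices it into a vertex, so such a half-edge
    changes neither the number of faces nor that of vertices. *)
Lemma ext_ins (e f : {perm T}) x :
  (ext e * ins f x)%g = ins (e * f)%g (e^-1%g x).
Proof.
apply/permP=> -[z|]; rewrite permM.
  rewrite extS !insS permM -(inj_eq (@perm_inj _ e) z) permKV.
  by case: eqP.
by rewrite extN !insN permM permKV.
Qed.

Lemma fcycle_ins (s : {perm T}) c x :
  uniq (rcons c x) -> fcycle s (rcons c x) ->
  fcycle (ins s x) (rcons (rcons (map Some c) (Some x)) None).
Proof.
have pathS c' z : x \notin belast z c' -> fpath s z c' ->
    fpath (ins s x) (Some z) (map Some c').
  elim: c' z => [//|u c' IH] z /=; rewrite inE negb_or eq_sym => /andP[zx xc].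
  move=> /andP[/eqP zu]; subst u => hp; rewrite insS (negbTE zx) eqxx /=.
  exact: IH.
rewrite -(map_rcons Some) rcons_uniq; case E : (rcons c x) => [|y c'].
  by case: (c) E.
have [cE xE] : c = belast y c' /\ x = last y c'.
  by move: E; rewrite lastI => /rcons_inj [-> ->].
rewrite cE => /andP[xc _]; rewrite /= !rcons_path /= last_rcons !last_map -xE.
rewrite insS eqxx insN => /andP[hp /eqP ->]; rewrite !eqxx !andbT.
exact: pathS.
Qed.

End Insertion.

(** * Rotation systems with a marked face *)

Lemma cyclic_eq_refl (A : Type) (u : word A) : cyclic_eq u u.
Proof. by exists 0; rewrite rot0. Qed.

Lemma cyclic_eq_rot (A : Type) (u v : word A) n :
  cyclic_eq u v -> cyclic_eq u (rot n v).
Proof. by move=> [k ->]; rewrite rot_rot_add; eexists. Qed.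

Lemma cyclic_eq_cat (A : Type) (u v : word A) : cyclic_eq (u ++ v) (v ++ u).
Proof. by exists (size u); rewrite rot_size_cat. Qed.

Lemma fcycle_porbit (T : finType) (s : {perm T}) c x y :
  fcycle s c -> x \in c -> y \in c -> x \in porbit s y.
Proof.
move=> sc xc yc; have := fconnect_cycle sc yc x; rewrite xc => /iter_findex <-.
by rewrite -permX mem_porbit.
Qed.

(** Composing with [tperm p q] exchanges the successors of [p] and [q], which cuts a cycle through
    both in two. *)
Lemma fcycle_split (T : finType) (g : {perm T}) p q A B :
  uniq (rcons A q ++ rcons B p) -> fcycle g (rcons A q ++ rcons B p) ->
  fcycle (tperm p q * g)%g (rcons A q) /\ fcycle (tperm p q * g)%g (rcons B p).
Proof.
have pathS c z : p \notin belast z c -> q \notin belast z c ->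
    fpath g z c -> fpath (tperm p q * g)%g z c.
  elim: c z => [//|u c IH] z /=; rewrite !inE !negb_or.
  move=> /andP[pz pc] /andP[qz qc] /andP[/eqP zu]; subst u => hp.
  by rewrite permM tpermD // eqxx; apply: IH.
case EA : (rcons A q) => [|a A']; first by case: (A) EA.
case EB : (rcons B p) => [|b B']; first by case: (B) EB.
have [AE qE] : A = belast a A' /\ q = last a A'.
  by move: EA; rewrite lastI => /rcons_inj [-> ->].
have [BE pE] : B = belast b B' /\ p = last b B'.
  by move: EB; rewrite lastI => /rcons_inj [-> ->].
rewrite -EA -EB cat_uniq !rcons_uniq => /and3P[/andP[qA _] dis /andP[pB _]].
have qB : q \notin rcons B p.
  by apply: contra dis => h; apply/hasP; exists q; rewrite // mem_rcons mem_head.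
have pA : p \notin A.
  apply: contra dis => h; apply/hasP; exists p.
    by rewrite mem_rcons mem_head.
  by rewrite /= mem_rcons inE h orbT.
have {}qB : q \notin B by apply: contra qB; rewrite mem_rcons inE orbC => ->.
rewrite EA EB /= rcons_cat cat_path /= !rcons_path /= -qE -pE.
move=> /and4P[hA /eqP gq hB /eqP gp].
rewrite !permM tpermL tpermR gq gp !eqxx !andbT.
by split; apply: pathS; rewrite -?AE -?BE.
Qed.

Section Diagrams.

Variables (A : Type) (Rel : word A -> Prop).

(** A [diagram] on an arbitrary type of darts, so that [option] can add some, whose outer face is a
    list, so that the boundary word has a starting point. *)
Record sphere_map (T : finType) (e f : {perm T}) (lab : T -> letter A)
    (c : seq T) : Prop := SphereMap {
  sm_edgeK : forall x, e (e x) = x;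
  sm_edge_neq : forall x, e x != x;
  sm_connected : forall x y,
    connect [rel u v | (v == e u) || (v == f u)] x y;
  sm_planar : #|porbits (e * f)%g| + #|porbits f| = #|porbits e| + 2;
  sm_label : forall x, lab (e x) = letter_inv (lab x);
  sm_uniq : uniq c;
  sm_neq0 : c != [::];
  sm_cycle : fcycle f c;
  sm_face : forall x, x \notin c -> exists2 r, Rel r &
    cyclic_eq r (face_label f lab x) \/
    cyclic_eq (word_inv r) (face_label f lab x)
}.

Definition disc (W : word A) (M : nat) : Prop :=
  exists (T : finType) (e f : {perm T}) (lab : T -> letter A) (c : seq T),
    [/\ sphere_map e f lab c, map lab c = W & #|T| <= M].

Lemma disc_le W M M' : M <= M' -> disc W M -> disc W M'.
Proof.
move=> le [T [e [f [lab [c [H E h]]]]]]; exists T, e, f, lab, c; split => //.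
exact: leq_trans h le.
Qed.

Lemma disc_rot k W M : disc W M -> disc (rot k W) M.
Proof.
move=> [T [e [f [lab [c [H <- h]]]]]]; exists T, e, f, lab, (rot k c).
split; rewrite ?map_rot //; case: H => eK e1 co pl le u c0 cy fa.
split; rewrite ?rot_uniq ?rot_cycle //.
  by rewrite -size_eq0 size_rot size_eq0.
by move=> x; rewrite mem_rot; apply: fa.
Qed.

Lemma disc_catC U V M : disc (U ++ V) M -> disc (V ++ U) M.
Proof. by rewrite -(rot_size_cat U V); apply: disc_rot. Qed.

(** A single edge: its only face runs along both sides, so the edge and face permutations coincide
    and there are two vertices. *)
Lemma disc_edge l : disc [:: l; letter_inv l] 2.
Proof.
have negI : injective negb by case; case.
pose e := perm negI.
exists bool, e, e, (fun b => if b then letter_inv l else l), [:: false; true].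
split; rewrite ?card_bool //=; split => //.
- by move=> x; rewrite !permE negbK.
- by move=> x; rewrite permE; case: x.
- move=> x y; case: (eqVneq x y) => [->|xy]; first exact: connect0.
  by apply: connect1; rewrite /= permE; case: (x) (y) xy => [] [].
- have -> : (e * e)%g = 1%g by apply/permP=> x; rewrite permM !permE negbK.
  have -> : #|porbits (1%g : {perm bool})| = 2.
    rewrite -card_bool /porbits card_imset //.
    move=> x y /eqP; rewrite eq_porbit_mem => /porbitP[i ->].
    by rewrite expg1n perm1.
  by rewrite addnC.
- by case=> /=; rewrite permE //= /letter_inv; case: (l) => u b; rewrite /= ?negbK.
- by rewrite /= !permE.
- by case.
Qed.

End Diagrams.

(** The term [0.*2] is what [porbits_mul_tperm] leaves when the transposed darts share an orbit,
    which then splits: a vertex for a spike, a face for a chord. *)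
Lemma euler_spike v v' f e : v + f = e + 2 -> v' + 0.*2 = v + 1 ->
  v' + f = e.+1 + 2.
Proof. lia. Qed.

Lemma euler_chord v f f' e : v + f = e + 2 -> f' + 0.*2 = f + 1 ->
  v + f' = e.+1 + 2.
Proof. lia. Qed.

(** * Adding an edge in the outer face *)

Section Attach.

Variables (A : Type) (Rel : word A -> Prop) (T : finType).
Variables (e f : {perm T}) (lab : T -> letter A) (cL cR : seq T).
Hypothesis H : sphere_map Rel e f lab (cL ++ cR).
Variable l : letter A.

Let i (x : T) : option (option T) := Some (Some x).
Let p : option (option T) := Some None.
Let q : option (option T) := None.

Let i_inj : injective i. Proof. by move=> x y []. Qed.

(** [E0] leaves the new darts [p] and [q] fixed, as two separate half-edges; [e'] joins them into
    one edge. *)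
Let E0 : {perm option (option T)} := ext (ext e).
Let e' : {perm option (option T)} := (tperm p q * E0)%g.

Let E0i x : E0 (i x) = i (e x). Proof. by rewrite /E0 !extS. Qed.
Let E0p : E0 p = p. Proof. by rewrite /E0 extS extN. Qed.
Let E0q : E0 q = q. Proof. by rewrite /E0 extN. Qed.

Let dart_cases (P : option (option T) -> Prop) :
  (forall x, P (i x)) -> P p -> P q -> forall z, P z.
Proof. by move=> Pi Pp Pq [[x|]|]; [apply: Pi | apply: Pp | apply: Pq]. Qed.

Let e'i x : e' (i x) = i (e x).
Proof. by rewrite permM tpermD // E0i. Qed.
Let e'p : e' p = q. Proof. by rewrite permM tpermL E0q. Qed.
Let e'q : e' q = p. Proof. by rewrite permM tpermR E0p. Qed.

Let e'E : e' = (E0 * tperm p q)%g.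
Proof.
apply/permP; elim/dart_cases => [x||]; rewrite [RHS]permM.
- by rewrite e'i E0i tpermD.
- by rewrite e'p E0p tpermL.
- by rewrite e'q E0q tpermR.
Qed.

Let e'K x : e' (e' x) = x.
Proof.
elim/dart_cases: x => [x||]; rewrite ?e'i ?e'p ?e'q ?e'i //.
by rewrite (sm_edgeK H).
Qed.

Let e'neq x : e' x != x.
Proof.
elim/dart_cases: x => [x||]; rewrite ?e'i ?e'p ?e'q //.
by rewrite (inj_eq i_inj) (sm_edge_neq H).
Qed.

Let card_e' : #|porbits e'| = #|porbits e|.+1.
Proof.
have /= := porbits_mul_tperm E0 p q.
by rewrite -/e' porbit_extN /E0 !card_porbits_ext /=; lia.
Qed.

Let lab' z : letter A :=
  match z with Some (Some x) => lab x | Some None => l | None => letter_inv l end.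

Let lab'e z : lab' (e' z) = letter_inv (lab' z).
Proof.
have lK : letter_inv (letter_inv l) = l by case: (l) => u b; rewrite /letter_inv /= negbK.
elim/dart_cases: z => [x||]; rewrite ?e'i ?e'p ?e'q //=.
by rewrite (sm_label H).
Qed.

(** Half-edges [q] and [p] enter the outer face without changing any count of vertices or faces.
    Spike and chord both arise from this stage by transposing [p] and [q]. *)
Let outer_insertion : exists F : {perm option (option T)},
  [/\ fcycle F (map i cL ++ q :: rcons (map i cR) p),
      forall x, x \notin cL ++ cR -> F (i x) = i (f x),
      #|porbits F| = #|porbits f| &
      #|porbits (E0 * F)%g| = #|porbits (e * f)%g|].
Proof.
have cc := sm_cycle H; have uu := sm_uniq H; have := sm_neq0 H.
case/lastP Ec : (cL ++ cR) => [//|c0 x] _.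
have := @fcycle_ins _ f c0 x; rewrite -Ec => /(_ uu cc).
(* The first insertion puts [p] after [cR]; rotating the cycle lets the second one put [q] after
   [cL]. *)
rewrite -map_rcons -Ec map_cat -cats1 -catA cycle_catC.
case/lastP Ec1 : ((map Some cR ++ [:: None]) ++ map Some cL) => [|c1 y].
  by case: (map Some cR) Ec1.
have u1 : uniq (rcons c1 y).
  rewrite -Ec1 -catA uniq_catCA -map_cat cons_uniq map_inj_uniq.
    rewrite uniq_catC uu andbT; apply/mapP => -[].
    by move=> z _.
  by move=> ? ? [].
move=> /(fcycle_ins u1); rewrite -map_rcons -Ec1 !map_cat -cats1 -catA cycle_catC.
rewrite -!catA -!map_comp /= => hF.
exists (ins (ins f x) y); split.
- by move: hF; rewrite cats1.
- move=> z zc; rewrite /i !insS.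
  have zx : z != x.
    by apply: contraNneq zc => ->; rewrite Ec mem_rcons mem_head.
  rewrite (negbTE zx); case: eqP => // zy; case/negP: zc.
  have : y \in rcons c1 y by rewrite mem_rcons mem_head.
  rewrite -Ec1 -zy !mem_cat => /orP[/orP[|]|].
  + by case/mapP=> ? ? [->]; apply/orP; right.
  + by rewrite inE.
  + by case/mapP=> ? ? [->]; apply/orP; left.
- by rewrite !card_porbits_ins.
- by rewrite !ext_ins !card_porbits_ins.
Qed.

(** Old paths survive except for steps along the outer face, which the second hypothesis
    replaces. *)
Let connected' (f' : {perm option (option T)}) :
  (forall x, x \notin cL ++ cR -> f' (i x) = i (f x)) ->
  {in p :: q :: map i (cL ++ cR) &, forall u v,
    connect [rel u v | (v == e' u) || (v == f' u)] u v} ->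
  forall u v, connect [rel u v | (v == e' u) || (v == f' u)] u v.
Proof.
move=> f'i spine u v; set r := [rel _ _ | _] in spine *.
have [x0 x0c] : exists x0, x0 \in cL ++ cR.
  by case: (cL ++ cR) (sm_neq0 H) => // x0 c _; exists x0; rewrite mem_head.
have isp x : x \in cL ++ cR -> i x \in p :: q :: map i (cL ++ cR).
  by move=> xc; rewrite !inE map_f.
have psp : p \in p :: q :: map i (cL ++ cR) by rewrite inE eqxx.
have qsp : q \in p :: q :: map i (cL ++ cR) by rewrite !inE eqxx orbT.
have stepi x y : connect r (i x) (i y).
  have /connectP[s hs ->] := sm_connected H x y.
  elim: s x hs => [|z s IH] x /= ; first by rewrite connect0.
  move=> /andP[xz /IH]; apply: connect_trans => {IH}.
  case/orP: xz => /eqP->; first by apply: connect1; rewrite /= e'i eqxx.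
  case: (boolP (x \in cL ++ cR)) => xc; last first.
    by apply: connect1; rewrite /= f'i // eqxx orbT.
  apply: spine; apply: isp => //.
  exact: (mem_fcycle (sm_cycle H)).
have toi w : connect r w (i x0).
  case: w => [[x|]|]; first exact: stepi.
    exact: (spine _ _ psp (isp _ x0c)).
  exact: (spine _ _ qsp (isp _ x0c)).
have fromi w : connect r (i x0) w.
  case: w => [[x|]|]; first exact: stepi.
    exact: (spine _ _ (isp _ x0c) psp).
  exact: (spine _ _ (isp _ x0c) qsp).
exact: connect_trans (toi u) (fromi v).
Qed.

Let face_label' (f' : {perm option (option T)}) x :
  (forall x, x \notin cL ++ cR -> f' (i x) = i (f x)) -> x \notin cL ++ cR ->
  exists k, face_label f' lab' (i x) = rot k (face_label f lab x).
Proof.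
move=> f'i xc.
have cyc : fcycle f' (map i (fingraph.orbit f x)).
  rewrite cycle_map; apply: (sub_in_cycle (e := frel f) (P := predC (mem (cL ++ cR)))).
  - by move=> y z /= yc _ /eqP <-; rewrite /= f'i.
  - apply/allP=> y; rewrite -fconnect_orbit => xy /=; apply: contra xc => yc.
    rewrite -(fconnect_cycle (sm_cycle H) yc) fconnect_sym //.
    exact: perm_inj.
  exact/cycle_orbit/perm_inj.
have [k E] : {k | fingraph.orbit f' (i x) = rot k (map i (fingraph.orbit f x))}.
  apply: orbit_rot_cycle => //; last by rewrite map_f ?in_orbit.
  by rewrite map_inj_uniq ?orbit_uniq.
by exists k; rewrite /face_label E map_rot -map_comp.
Qed.

Let perm_outer : perm_eq (map i cL ++ q :: rcons (map i cR) p)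
                         (p :: q :: map i (cL ++ cR)).
Proof.
apply/seq.permP=> P; rewrite map_cat -cats1 /= !count_cat /= !count_cat /=.
by lia.
Qed.

Let uniq_outer : uniq (map i cL ++ q :: rcons (map i cR) p).
Proof.
rewrite (perm_uniq perm_outer) /= (map_inj_uniq i_inj) (sm_uniq H) !inE /= andbT.
by apply/andP; split; apply/mapP=> -[].
Qed.

(** Only the edge permutation is multiplied by [tperm p q]. As [p] and [q] lie in one orbit of
    [E0 * F], that orbit splits and one vertex appears. *)
Lemma attach_spike : cL = [::] -> exists f' : {perm option (option T)},
  sphere_map Rel e' f' lab' (q :: rcons (map i cR) p).
Proof.
move=> cL0; have [F [cyc Fi cF cEF]] := outer_insertion.
have uo := uniq_outer; have po := perm_outer; have sp := connected' Fi.
have cyc1 := cyc; rewrite cL0 /= in cyc1 uo po.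
exists F; split => //.
- apply: sp => u v; rewrite -!(perm_mem perm_outer) => uc vc.
  apply: (connect_cycle (p := map i cL ++ q :: rcons (map i cR) p)) => //.
  by apply: sub_cycle cyc => x y /eqP <-; rewrite /= eqxx orbT.
- have /= := porbits_mul_tperm (E0 * F)%g p q.
  have -> : (p \notin porbit (E0 * F)%g q) = false.
    apply/negbF; rewrite porbit_sym.
    have <- : (E0 * F)%g p = q; last exact: (mem_porbit (E0 * F)%g 1).
    by move: cyc1; rewrite permM E0p /= rcons_path last_rcons => /andP[_ /eqP].
  rewrite mulgA -/e' cEF cF card_e' /=; move: (sm_planar H).
  exact: euler_spike.
- move=> z zo; have : z \notin p :: q :: map i (cL ++ cR).
    by rewrite cL0 /= -(perm_mem po).
  elim/dart_cases: z {zo} => [x||]; rewrite ?inE ?eqxx ?orbT //=.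
  rewrite (mem_map i_inj) => xc.
  have [k ->] := face_label' Fi xc.
  have [r Rr hr] := sm_face H xc; exists r => //.
  by case: hr => hr; [left|right]; apply: cyclic_eq_rot.
Qed.

(** Edge and face permutations are both multiplied by [tperm p q]: the factors cancel in the vertex
    permutation, while the outer face splits into [cL q], a new cell, and [cR p]. *)
Lemma attach_chord :
  (exists2 r, Rel r & cyclic_eq r (map lab cL ++ [:: letter_inv l]) \/
                      cyclic_eq (word_inv r) (map lab cL ++ [:: letter_inv l])) ->
  exists f' : {perm option (option T)},
    sphere_map Rel e' f' lab' (rcons (map i cR) p).
Proof.
move=> [r Rr hr]; have [F [cyc Fi cF cEF]] := outer_insertion.
have uo := uniq_outer; have po := perm_outer.
have spl := @fcycle_split _ F p q (map i cL) (map i cR).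
rewrite -cat_rcons in cyc uo po; have [cycL cycR] := spl uo cyc.
set f' := (tperm p q * F)%g in cycL cycR.
have f'i x : x \notin cL ++ cR -> f' (i x) = i (f x).
  by move=> xc; rewrite permM tpermD // Fi.
exists f'; split => //.
- apply: connected' => // u v; rewrite -!(perm_mem po) !mem_cat.
  set r0 := [rel _ _ | _].
  have inc c : fcycle f' c -> {in c &, forall u v, connect r0 u v}.
    move=> cc; apply: connect_cycle; apply: sub_cycle cc => x y /eqP <-.
    by rewrite /= eqxx orbT.
  have pq : connect r0 p q by apply: connect1; rewrite /= e'p eqxx.
  have qp : connect r0 q p by apply: connect1; rewrite /= e'q eqxx.
  have qL : q \in rcons (map i cL) q by rewrite mem_rcons mem_head.
  have pR : p \in rcons (map i cR) p by rewrite mem_rcons mem_head.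
  case/orP=> hu /orP[] hv; try exact: (inc _ cycL); try exact: (inc _ cycR).
    apply: connect_trans (inc _ cycL _ _ hu qL) _.
    exact: connect_trans qp (inc _ cycR _ _ pR hv).
  apply: connect_trans (inc _ cycR _ _ hu pR) _.
  exact: connect_trans pq (inc _ cycL _ _ qL hv).
- have -> : (e' * f')%g = (E0 * F)%g.
    by rewrite e'E /f' mulgA -(mulgA E0) tperm2 mulg1.
  have /= := porbits_mul_tperm F p q.
  have -> : (p \notin porbit F q) = false.
    apply/negbF; apply: (fcycle_porbit cyc).
      by rewrite mem_cat !mem_rcons !inE eqxx orbT.
    by rewrite mem_cat !mem_rcons !inE eqxx.
  rewrite -/f' cEF cF card_e' /=; move: (sm_planar H).
  exact: euler_chord.
- by move: uo; rewrite cat_uniq => /and3P[].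
- by case: (map i cR).
- move=> z zo; have zn : z \in p :: q :: map i (cL ++ cR) -> z \in rcons (map i cL) q.
    by rewrite -(perm_mem po) mem_cat (negbTE zo) orbF.
  case: (boolP (z \in rcons (map i cL) q)) => [zL|zL].
    have [k E] : {k | fingraph.orbit f' z = rot k (rcons (map i cL) q)}.
      apply: orbit_rot_cycle => //.
      by move: uo; rewrite cat_uniq => /and3P[].
    exists r => //; rewrite /face_label E map_rot map_rcons -map_comp -cats1 /=.
    by case: hr => hr; [left|right]; apply: cyclic_eq_rot.
  have {zn} : z \notin p :: q :: map i (cL ++ cR) by exact: contra zn zL.
  elim/dart_cases: z {zo zL} => [x||]; rewrite ?inE ?eqxx ?orbT //=.
  rewrite (mem_map i_inj) => xc.
  have [k ->] := face_label' f'i xc.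
  have [r1 Rr1 hr1] := sm_face H xc; exists r1 => //.
  by case: hr1 => hr1; [left|right]; apply: cyclic_eq_rot.
Qed.

End Attach.

(** * Operations on boundary words, and the passage to [diagram] *)

Section DiscOperations.

Variables (A : Type) (Rel : word A -> Prop).

Lemma disc_spike (W : word A) M l :
  disc Rel W M -> disc Rel (W ++ [:: l; letter_inv l]) (M + 2).
Proof.
move=> [T [e [f [lab [c [H EW h]]]]]].
have [f' H'] := attach_spike (cL := [::]) H l erefl.
have -> : W ++ [:: l; letter_inv l] = (W ++ [:: l]) ++ [:: letter_inv l].
  by rewrite -catA.
apply: disc_catC.
do 5!eexists; split; [exact: H'| |by rewrite !card_option; lia].
by rewrite /= map_rcons -map_comp cats1 -EW.
Qed.

Lemma disc_chord (U V : word A) M l :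
  (exists2 r, Rel r & cyclic_eq r (U ++ [:: letter_inv l]) \/
                      cyclic_eq (word_inv r) (U ++ [:: letter_inv l])) ->
  disc Rel (U ++ V) M -> disc Rel (V ++ [:: l]) (M + 2).
Proof.
move=> hr [T [e [f [lab [c [H EW h]]]]]].
have Ec : c = take (size U) c ++ drop (size U) c by rewrite cat_take_drop.
have EU : map lab (take (size U) c) = U by rewrite map_take EW take_size_cat.
have EV : map lab (drop (size U) c) = V by rewrite map_drop EW drop_size_cat.
rewrite Ec in H; rewrite -EU in hr.
have [f' H'] := attach_chord H hr.
do 5!eexists; split; [exact: H'| |by rewrite !card_option; lia].
by rewrite map_rcons -map_comp cats1 -EV.
Qed.

Lemma disc_diagram W M : disc Rel W M ->
  exists2 Delta : diagram Rel, boundary_label Delta W & num_darts Delta <= M.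
Proof.
move=> [T [e [f [lab [c [H EW h]]]]]].
pose h0 (x : T) : 'I_#|T| := enum_rank x.
pose h1 : 'I_#|T| -> T := enum_val.
have h0K : cancel h0 h1 by exact: enum_rankK.
have h1K : cancel h1 h0 by exact: enum_valK.
have h0_bij : bijective h0 by exists h1.
have h0_inj := bij_inj h0_bij.
have conj_inj (s : {perm T}) : injective (fun y => h0 (s (h1 y))).
  by move=> x y /h0_inj /perm_inj /(can_inj h1K).
pose cj s := perm (@conj_inj s).
have cjE s x : cj s (h0 x) = h0 (s x) by rewrite permE h0K.
have card_cj s : #|porbits (cj s)| = #|porbits s| by apply: card_porbits_bij (cjE s).
have cjM s t : cj (s * t)%g = (cj s * cj t)%g.
  by apply/permP=> x; rewrite permM !permE h0K.
have [x0 x0c] : exists x0, x0 \in c.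
  by case: (c) (sm_neq0 H) => // y c' _; exists y; rewrite mem_head.
have fcyc s : fcycle f s -> fcycle (cj f) (map h0 s).
  by apply: homo_cycle => x y /eqP <-; rewrite /= cjE.
pose lab' : 'I_#|T| -> letter A := lab \o h1.
have flE s x : fcycle f s -> uniq s -> x \in s ->
    exists k, face_label (cj f) lab' (h0 x) = rot k (map lab s).
  move=> sc su sx.
  have [k E] : {k | fingraph.orbit (cj f) (h0 x) = rot k (map h0 s)}.
    by apply: orbit_rot_cycle; rewrite ?map_inj_uniq ?map_f //; apply: fcyc.
  exists k; rewrite /face_label E map_rot -map_comp; congr (rot _ _).
  by apply: eq_map => y; rewrite /lab' /= h0K.
have eK x : cj e (cj e x) = x.
  by rewrite -(h1K x) !cjE (sm_edgeK H).
have en x : cj e x != x.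
  by rewrite -(h1K x) cjE (inj_eq h0_inj) (sm_edge_neq H).
have co x y : connect [rel u v | (v == cj e u) || (v == cj f u)] x y.
  rewrite -(h1K x) -(h1K y).
  have /connectP[s hs ->] := sm_connected H (h1 x) (h1 y).
  apply/connectP; exists (map h0 s); last by rewrite last_map.
  by apply: homo_path hs => u v /= /orP[] /eqP ->; rewrite !cjE !eqxx ?orbT.
have pl : #|porbits (vertex_perm (cj e) (cj f))| + #|porbits (cj f)|
          = #|porbits (cj e)| + 2.
  by rewrite /vertex_perm -cjM !card_cj (sm_planar H).
have lE (x : 'I_#|T|) : lab' (cj e x) = letter_inv (lab' x).
  by rewrite -(h1K x) cjE /lab' /= !h0K (sm_label H).
have fa x : x \notin porbit (cj f) (h0 x0) -> exists2 r, Rel r &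
    cyclic_eq r (face_label (cj f) lab' x) \/
    cyclic_eq (word_inv r) (face_label (cj f) lab' x).
  rewrite -(h1K x) => xo; have {}xo : h1 x \notin c.
    apply: contra xo => xc; apply: (fcycle_porbit (fcyc _ (sm_cycle H)));
    exact: map_f.
  have [r Rr hr] := sm_face H xo; exists r => //.
  have [k ->] := flE (fingraph.orbit f (h1 x)) (h1 x)
    (cycle_orbit (@perm_inj _ f) _) (orbit_uniq _ _) (in_orbit _ _).
  by case: hr => hr; [left|right]; apply: cyclic_eq_rot.
exists (Diagram eK en co pl lE fa) => //.
rewrite /boundary_label /= -EW.
have [k ->] := flE c x0 (sm_cycle H) (sm_uniq H) x0c.
(* [boundary_label] asks for the opposite rotation, from the orbit of the outer dart to [W]. *)
by exists (size (rot k (map lab c)) - k); rewrite -[RHS]/(rotr k _) rotK.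
Qed.

(** Cells of each dimension are orbits of darts, so one bound serves all three Dehn functions. *)
Lemma num_cells_le (j : 'I_3) (Delta : diagram Rel) :
  num_cells j Delta <= num_darts Delta.
Proof.
have le (s : {perm 'I_(num_darts Delta)}) : #|porbits s| <= num_darts Delta.
  by apply: leq_trans (card_porbits_le s) _; rewrite card_ord.
case: j => [[|[|j]] hj]; rewrite /num_cells /=; try exact: le.
exact: leq_trans (leq_pred _) (le _).
Qed.

End DiscOperations.

(** * Boundary rewriting without folding *)

Definition pos (w : seq gen) : word gen := [seq (x, false) | x <- w].

Lemma pos_cat u v : pos (u ++ v) = pos u ++ pos v.
Proof. exact: map_cat. Qed.

(* Replacing r2 by r1 in the boundary costs k darts.  Working from r1 towards
   r2, only single letters are expanded and only pairs l l^-1 are erased, so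
   no two edges of a diagram ever have to be identified. *)
Definition rewrites (r1 r2 : word gen) (k : nat) : Prop := forall p q M,
  disc lysenok (p ++ r2 ++ q) M -> disc lysenok (p ++ r1 ++ q) (M + k).

Lemma rewrites_refl r : rewrites r r 0.
Proof. by move=> p q M; rewrite addn0. Qed.

Lemma rewrites_trans r1 r2 r3 k k' :
  rewrites r1 r2 k -> rewrites r2 r3 k' -> rewrites r1 r3 (k + k').
Proof. by move=> h h' p q M /h' /h; rewrite addnAC addnA. Qed.

Lemma rewrites_ctx u v r1 r2 k :
  rewrites r1 r2 k -> rewrites (u ++ r1 ++ v) (u ++ r2 ++ v) k.
Proof.
move=> h p q M; have /= := h (p ++ u) (v ++ q) M.
by rewrite -!catA.
Qed.
Arguments rewrites_ctx u v [r1 r2 k].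

Lemma rewrites_spike l : rewrites [:: l; letter_inv l] [::] 2.
Proof.
move=> p q M /disc_catC /(disc_spike l).
by rewrite -catA => /disc_catC; rewrite -catA.
Qed.

Lemma rewrites_chord l r2 :
  (exists2 r, lysenok r & cyclic_eq r (r2 ++ [:: letter_inv l]) \/
                          cyclic_eq (word_inv r) (r2 ++ [:: letter_inv l])) ->
  rewrites [:: l] r2 2.
Proof.
move=> hr p q M /disc_catC; rewrite -catA => /(disc_chord hr).
by rewrite -catA => /disc_catC; rewrite -catA.
Qed.

(** The relator x^2 is a bigon glued along one side, so signs of letters can be changed at bounded
    cost. *)
Lemma rewrites_flip x b : rewrites [:: (x, b)] [:: (x, ~~ b)] 2.
Proof.
apply: rewrites_chord; exists [:: (x, false); (x, false)].
  by case: x; constructor.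
by case: b; [left|right]; apply: cyclic_eq_refl.
Qed.

Lemma rewrites_flips (s s' : word gen) : map fst s = map fst s' ->
  rewrites s s' (2 * size s).
Proof.
elim: s s' => [|[x b] s IH] [|[x' b'] s'] //=.
  by move=> _; apply: rewrites_refl.
case=> <- /IH h; have h1 : rewrites [:: (x, b)] [:: (x, b')] 2.
  case: (eqVneq b b') => [->|bb].
    by move=> p q M /disc_le; apply; rewrite leq_addr.
  by have := @rewrites_flip x b; case: b b' bb => [] [].
have h2 := rewrites_ctx [:: (x, b')] [::] h; rewrite !cats0 in h2.
by rewrite mulnS; apply: rewrites_trans (rewrites_ctx [::] s h1) h2.
Qed.

(** The cost is forgotten: finitely many instances are needed, and [fin_bound] recovers a common
    constant. *)
Definition Rewrites (u v : seq gen) : Prop := exists k, rewrites (pos u) (pos v) k.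

Lemma Rewrites_trans u v w : Rewrites u v -> Rewrites v w -> Rewrites u w.
Proof.
by move=> [k h] [k' h']; exists (k + k'); apply: rewrites_trans h h'.
Qed.

Lemma Rewrites_ctx p q u v : Rewrites u v -> Rewrites (p ++ u ++ q) (p ++ v ++ q).
Proof. by move=> [k h]; exists k; rewrite !pos_cat; apply: rewrites_ctx. Qed.

Lemma Rewrites_erase x : Rewrites [:: x; x] [::].
Proof.
eexists; apply: rewrites_trans (rewrites_spike (x, false)).
exact: (@rewrites_flips _ [:: (x, false); (x, true)]).
Qed.

Lemma Rewrites_chord l (s : word gen) :
  (exists2 r, lysenok r & cyclic_eq r (s ++ [:: letter_inv l]) \/
                          cyclic_eq (word_inv r) (s ++ [:: letter_inv l])) ->
  Rewrites [:: l.1] (map fst s).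
Proof.
move=> hr; eexists; apply: rewrites_trans (rewrites_trans (rewrites_chord hr) _).
  exact: (@rewrites_flips [:: (l.1, false)] [:: l]).
by apply: rewrites_flips; rewrite -map_comp map_id.
Qed.

(** The six orderings of b, c, d, that is, the relations x = yz among distinct nontrivial elements
    of the Klein group. *)
Definition klein (x y z : gen) : bool :=
  match x, y, z with
  | gb, gc, gd | gb, gd, gc | gc, gb, gd | gc, gd, gb | gd, gb, gc | gd, gc, gb
    => true
  | _, _, _ => false
  end.

Lemma Rewrites_klein x y z : klein x y z -> Rewrites [:: x] [:: y; z].
Proof.
have bcd := lys_bcd.
case: x y z => [] [] [] //= _.
- by apply: (@Rewrites_chord (gb, true) (pos [:: gc; gd])); exists (wb ++ wc ++ wd) => //; left; exists 1.
- by apply: (@Rewrites_chord (gb, false) [:: (gd, true); (gc, true)]); exists (wb ++ wc ++ wd) => //; right; exists 0.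
- by apply: (@Rewrites_chord (gc, false) [:: (gb, true); (gd, true)]); exists (wb ++ wc ++ wd) => //; right; exists 2.
- by apply: (@Rewrites_chord (gc, true) (pos [:: gd; gb])); exists (wb ++ wc ++ wd) => //; left; exists 2.
- by apply: (@Rewrites_chord (gd, true) (pos [:: gb; gc])); exists (wb ++ wc ++ wd) => //; left; exists 0.
- by apply: (@Rewrites_chord (gd, false) [:: (gc, true); (gb, true)]); exists (wb ++ wc ++ wd) => //; right; exists 1.
Qed.

Lemma Rewrites_d : Rewrites [:: gd] [:: ga; gd; ga; gd; ga; gd; ga].
Proof.
apply: (@Rewrites_chord (gd, true) (pos [:: ga; gd; ga; gd; ga; gd; ga])).
by exists (word_pow (wa ++ wd) 4); [exact: (lys_ad 0) | left; exists 0].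
Qed.

Lemma Rewrites_a : Rewrites [:: ga] [:: gd; ga; gd; ga; gd; ga; gd].
Proof.
apply: (@Rewrites_chord (ga, true) (pos [:: gd; ga; gd; ga; gd; ga; gd])).
by exists (word_pow (wa ++ wd) 4); [exact: (lys_ad 0) | left; exists 1].
Qed.

Tactic Notation "at_ctx" uconstr(p) uconstr(q) uconstr(lem) :=
  (refine (@Rewrites_trans _ _ _ (@Rewrites_ctx p q _ _ lem) _); rewrite /=).

Lemma Rewrites_refl u : Rewrites u u. Proof. by exists 0; apply: rewrites_refl. Qed.

Lemma Rewrites_adada : Rewrites [:: ga; gd; ga; gd; ga] [:: gd; ga; gd].
Proof.
at_ctx [::] [:: gd; ga; gd; ga] Rewrites_a.
at_ctx [:: gd; ga; gd; ga; gd; ga] [:: ga; gd; ga] (Rewrites_erase gd).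
at_ctx [:: gd; ga; gd; ga; gd] [:: gd; ga] (Rewrites_erase ga).
at_ctx [:: gd; ga; gd; ga] [:: ga] (Rewrites_erase gd).
at_ctx [:: gd; ga; gd] [::] (Rewrites_erase ga).
exact: Rewrites_refl.
Qed.

Lemma Rewrites_dadad : Rewrites [:: gd; ga; gd; ga; gd] [:: ga; gd; ga].
Proof.
at_ctx [::] [:: ga; gd; ga; gd] Rewrites_d.
at_ctx [:: ga; gd; ga; gd; ga; gd] [:: gd; ga; gd] (Rewrites_erase ga).
at_ctx [:: ga; gd; ga; gd; ga] [:: ga; gd] (Rewrites_erase gd).
at_ctx [:: ga; gd; ga; gd] [:: gd] (Rewrites_erase ga).
at_ctx [:: ga; gd; ga] [::] (Rewrites_erase gd).
exact: Rewrites_refl.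
Qed.

(** The substitute for folding: a pair [y y] is absorbed by the letter before it. Klein expansions
    settle the pairs within b, c, d, and (ad)^4 those of a with d; [via_d] and [to_a] reduce the
    others to these. *)
Lemma Rewrites_insert_right x y : Rewrites [:: x] [:: x; y; y].
Proof.
have d_aad : Rewrites [:: gd] [:: ga; ga; gd].
  at_ctx [::] [::] Rewrites_d; at_ctx [:: ga] [:: ga] Rewrites_dadad.
  at_ctx [:: ga; ga; gd] [::] (Rewrites_erase ga); exact: Rewrites_refl.
have d_daa : Rewrites [:: gd] [:: gd; ga; ga].
  at_ctx [::] [::] Rewrites_d; at_ctx [:: ga] [:: ga] Rewrites_dadad.
  at_ctx [::] [:: gd; ga; ga] (Rewrites_erase ga); exact: Rewrites_refl.
have a_add : Rewrites [:: ga] [:: ga; gd; gd].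
  at_ctx [::] [::] Rewrites_a; at_ctx [:: gd] [:: gd] Rewrites_adada.
  at_ctx [::] [:: ga; gd; gd] (Rewrites_erase gd); exact: Rewrites_refl.
have kl u v w : klein u v w -> [/\ Rewrites [:: u] [:: u; v; v],
    Rewrites [:: u] [:: v; v; u] & Rewrites [:: u] [:: u; u; u]].
  move=> uvw.
  have [[uwv vuw] [wuv wvu]] : (klein u w v /\ klein v u w) /\
      (klein w u v /\ klein w v u) by case: u v w uvw => [] [] [].
  have h : Rewrites [:: u] [:: u; v; v].
    at_ctx [::] [::] (Rewrites_klein uwv).
    at_ctx [::] [:: v] (Rewrites_klein wuv); exact: Rewrites_refl.
  split=> //.
    at_ctx [::] [::] (Rewrites_klein uvw).
    at_ctx [:: v] [::] (Rewrites_klein wvu); exact: Rewrites_refl.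
  at_ctx [::] [::] h.
  at_ctx [:: u] [:: v] (Rewrites_klein vuw).
  at_ctx [:: u; u] [:: v] (Rewrites_klein wuv).
  at_ctx [:: u; u; u] [::] (Rewrites_erase v); exact: Rewrites_refl.
have via_d z : Rewrites [:: gd] [:: z; z; gd] -> Rewrites [:: ga] [:: ga; z; z].
  move=> h; at_ctx [::] [::] a_add; at_ctx [:: ga] [:: gd] h.
  at_ctx [:: ga; z; z] [::] (Rewrites_erase gd); exact: Rewrites_refl.
have to_a z : Rewrites [:: z] [:: z; gd; gd] -> Rewrites [:: z] [:: z; ga; ga].
  move=> h; at_ctx [::] [::] h; at_ctx [:: z] [:: gd] d_aad.
  at_ctx [:: z; ga; ga] [::] (Rewrites_erase gd); exact: Rewrites_refl.
have [bc cb bb] := kl gb gc gd isT; have [bd db _] := kl gb gd gc isT.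
have [cb1 bc1 cc] := kl gc gb gd isT; have [cd dc _] := kl gc gd gb isT.
have [db1 bd1 dd] := kl gd gb gc isT; have [dc1 cd1 _] := kl gd gc gb isT.
by case: x y => [] [] //; [exact: via_d | exact: via_d | exact: via_d
  | exact: to_a | exact: to_a].
Qed.

(** * Inserting and erasing inverse pairs and relators *)

Lemma letter_invK (A : Type) : involutive (@letter_inv A).
Proof. by case=> x b; rewrite /letter_inv /= negbK. Qed.

Lemma word_inv_cat (A : Type) (u v : word A) :
  word_inv (u ++ v) = word_inv v ++ word_inv u.
Proof. by rewrite /word_inv map_cat rev_cat. Qed.

Lemma word_invK (A : Type) : involutive (@word_inv A).
Proof.
move=> w; rewrite /word_inv map_rev revK -map_comp.
by rewrite (eq_map (@letter_invK A)) map_id.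
Qed.

Lemma cyclic_eq_inv (A : Type) (u v : word A) :
  cyclic_eq u v -> cyclic_eq (word_inv u) (word_inv v).
Proof.
move=> [k ->]; rewrite /rot -{1}(cat_take_drop k u) !word_inv_cat.
exact: cyclic_eq_cat.
Qed.

Definition is_relator (s : word gen) : Prop :=
  exists2 r, lysenok r & cyclic_eq r s \/ cyclic_eq (word_inv r) s.

Lemma is_relator_inv s : is_relator s -> is_relator (word_inv s).
Proof.
move=> [r Rr hr]; exists r => //.
by case: hr => /cyclic_eq_inv; rewrite ?word_invK; [right | left].
Qed.

Lemma is_relator_rot k s : is_relator s -> is_relator (rot k s).
Proof.
move=> [r Rr hr]; exists r => //.
by case: hr => h; [left|right]; apply: cyclic_eq_rot.
Qed.

Lemma rewrites_spikes w : rewrites (w ++ word_inv w) [::] (2 * size w).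
Proof.
elim/last_ind: w => [|w l IH]; first exact: rewrites_refl.
rewrite size_rcons mulnS -cats1 word_inv_cat -catA.
apply: rewrites_trans IH.
exact: (rewrites_ctx w (word_inv w) (rewrites_spike l)).
Qed.

(** Expanding the last letter of the relator into the inverse of the others leaves a word followed
    by its inverse. *)
Lemma rewrites_relator s : s <> [::] -> is_relator s -> rewrites s [::] (2 * size s).
Proof.
case/lastP: s => [//|s l] _ hs; rewrite size_rcons mulnS.
have {hs} hc : rewrites [:: l] (word_inv s) 2.
  apply/rewrites_chord/(_ : is_relator _).
  have <- : word_inv (l :: s) = word_inv s ++ [:: letter_inv l].
    by rewrite -cat1s word_inv_cat.
  apply: is_relator_inv.
  have -> : l :: s = rot (size s) (rcons s l) by rewrite -cats1 rot_size_cat.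
  exact: is_relator_rot.
have h := rewrites_ctx s [::] hc; rewrite !cats0 cats1 in h.
exact: rewrites_trans h (rewrites_spikes s).
Qed.

Lemma rewrites_le r1 r2 k k' : k <= k' -> rewrites r1 r2 k -> rewrites r1 r2 k'.
Proof.
by move=> le h p q M /h; apply: disc_le; rewrite leq_add2l.
Qed.

Lemma fin_bound (T : finType) (P : T -> nat -> Prop) :
  (forall x m n, m <= n -> P x m -> P x n) -> (forall x, exists n, P x n) ->
  exists K, forall x, P x K.
Proof.
move=> P_le /fin_all_exists [k hk]; exists (\max_x k x) => x.
by apply: P_le (hk x); apply: leq_bigmax.
Qed.

(** The pair is absorbed by a neighbouring letter, after a rotation if it stands first; [p ++ q]
    must provide that letter. *)
Lemma disc_unpair : exists K, forall p q l M, p ++ q <> [::] ->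
  disc lysenok (p ++ [:: l; letter_inv l] ++ q) M ->
  disc lysenok (p ++ q) (M + K).
Proof.
have [K0 hK0] : exists K, forall xy : gen * gen,
    rewrites (pos [:: xy.1]) (pos [:: xy.1; xy.2; xy.2]) K.
  apply: fin_bound => [[x y] m n le|[x y]]; first exact: rewrites_le.
  exact: Rewrites_insert_right.
(* One sign flip before the absorption and three after it, at two darts each. *)
exists (2 + (K0 + 6)).
have hr u z l M : disc lysenok (rcons u z ++ [:: l; letter_inv l]) M ->
    disc lysenok (rcons u z) (M + (2 + (K0 + 6))).
  case: z l => [x b] [y c] h; rewrite -cats1 -(cats0 (u ++ _)) -catA.
  have h1 := @rewrites_flips [:: (x, b)] (pos [:: x]) erefl.
  have h2 := @rewrites_flips (pos [:: x; y; y]) [:: (x, b); (y, c); (y, ~~ c)] erefl.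
  apply: (rewrites_trans h1 (rewrites_trans (hK0 (x, y)) h2)).
  by rewrite -cats1 -catA in h.
move=> p q l M pq; case/lastP: p pq => [|p z] pq.
  case/lastP: q pq => [//|q z] _ h.
  exact/hr/(@disc_catC _ _ [:: l; letter_inv l] (rcons q z)).
rewrite catA => /disc_catC; rewrite catA => h.
apply: (@disc_catC _ _ q (rcons p z)); rewrite -rcons_cat; apply: (hr _ _ l).
by rewrite rcons_cat.
Qed.

Lemma disc_unpairs : exists K, forall w p q M, p ++ q <> [::] ->
  disc lysenok (p ++ w ++ word_inv w ++ q) M ->
  disc lysenok (p ++ q) (M + K * size w).
Proof.
have [K hK] := disc_unpair; exists K; elim/last_ind => [|w l IH] p q M pq.
  by rewrite muln0 addn0.
rewrite size_rcons mulnS addnA => h; apply: IH => //.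
rewrite catA; apply: (hK _ _ l).
  by case: p pq {h} => //; case: w => //; case: q.
by move: h; rewrite -cats1 word_inv_cat -!catA.
Qed.

(** Insertion and erasure of [s]; erasure must leave a nonempty boundary, since a [disc] has at
    least one dart. *)
Definition cancellable (s : word gen) (k : nat) : Prop :=
  rewrites s [::] k /\ forall p q M, p ++ q <> [::] ->
    disc lysenok (p ++ s ++ q) M -> disc lysenok (p ++ q) (M + k).

Lemma cancellable_pair : exists K, forall w, cancellable (w ++ word_inv w) (K * size w).
Proof.
have [K hK] := disc_unpairs; exists (K + 2) => w; split.
  by apply: rewrites_le (@rewrites_spikes w); rewrite leq_mul // leq_addl.
move=> p q M pq; rewrite -catA => /hK => /(_ pq); apply: disc_le.
by rewrite leq_add2l leq_mul // leq_addr.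
Qed.

(** To erase [s], the relator [word_inv s] is inserted after it and the resulting inverse pairs are
    removed. *)
Lemma cancellable_relator : exists K, forall s, s <> [::] -> is_relator s ->
  cancellable s (K * size s).
Proof.
have [K hK] := disc_unpairs; exists (K + 2) => s s0 hs; split.
  by apply: rewrites_le (rewrites_relator s0 hs); rewrite leq_mul // leq_addl.
move=> p q M pq h.
have s0' : word_inv s <> [::] by move/(congr1 (@word_inv _)); rewrite word_invK.
have := rewrites_relator s0' (is_relator_inv hs) (p := p ++ s) (q := q) (M := M).
rewrite -catA => /(_ h); rewrite -catA => /(hK _ _ _ _ pq); apply: disc_le.
by rewrite /word_inv size_rev size_map; lia.
Qed.

Lemma cancellable_le s k k' : k <= k' -> cancellable s k -> cancellable s k'.
Proof.
move=> le [h1 h2]; split; first exact: rewrites_le h1.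
by move=> p q M pq /(h2 _ _ _ pq); apply: disc_le; rewrite leq_add2l.
Qed.

Lemma cancellable_flips s s' k : map fst s = map fst s' ->
  cancellable s k -> cancellable s' (2 * size s + k).
Proof.
move=> E [h1 h2].
have sE : size s = size s' by rewrite -(size_map fst s) E size_map.
split; first by apply: rewrites_trans h1; rewrite sE; apply: rewrites_flips.
move=> p q M pq /(@rewrites_flips s s' E) /(h2 _ _ _ pq); apply: disc_le.
by rewrite addnA.
Qed.

(** * The substitution sigma on positive words *)

Definition sg_gen (g : gen) : seq gen :=
  match g with ga => [:: ga; gc; ga] | gb => [:: gd] | gc => [:: gb] | gd => [:: gc] end.

Definition sg (w : seq gen) : seq gen := flatten (map sg_gen w).

Lemma sg_cat u v : sg (u ++ v) = sg u ++ sg v.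
Proof. by rewrite /sg map_cat flatten_cat. Qed.

Lemma iter_sg_cat k u v : iter k sg (u ++ v) = iter k sg u ++ iter k sg v.
Proof. by elim: k => //= k ->; rewrite sg_cat. Qed.

Lemma iter_sg_nil k : iter k sg [::] = [::].
Proof. by elim: k => //= k ->. Qed.

Lemma fst_pos w : map fst (pos w) = w.
Proof. by rewrite -map_comp map_id. Qed.

Lemma fst_word_inv (A : Type) (s : word A) :
  map fst (word_inv s) = rev (map fst s).
Proof. by rewrite /word_inv map_rev -map_comp. Qed.

Lemma pos_sg w : pos (sg w) = sigma (pos w).
Proof.
elim: w => //= x w IH; rewrite -cat1s sg_cat pos_cat IH.
by rewrite /sigma /=; case: x.
Qed.

Lemma pos_iter_sg k w : pos (iter k sg w) = iter k sigma (pos w).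
Proof. by elim: k => //= k IH; rewrite pos_sg IH. Qed.

Lemma rev_sg w : rev (sg w) = sg (rev w).
Proof.
elim: w => //= x w IH; rewrite -cat1s sg_cat !rev_cat sg_cat IH.
by case: x.
Qed.

Lemma rev_iter_sg k w : rev (iter k sg w) = iter k sg (rev w).
Proof. by elim: k => //= k IH; rewrite rev_sg IH. Qed.

(** As sigma permutes b, c, d cyclically, it merely rotates bcd, so all the images are relators up
    to rotation. *)
Lemma iter_sg_klein k :
  iter k sg [:: gb; gc; gd] \in [:: [:: gb; gc; gd]; [:: gd; gb; gc]; [:: gc; gd; gb]].
Proof.
by elim: k => [|k]; rewrite ?inE ?eqxx //= => /or3P[] /eqP->; rewrite eqxx ?orbT.
Qed.

Lemma leq_size_iter_sg k w : size w <= size (iter k sg w).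
Proof.
elim: k => //= k; move/leq_trans; apply; elim: (iter k sg w) => //= x u IH.
by rewrite -cat1s sg_cat size_cat; case: x => //=; rewrite ?addSn ?add0n ltnS //; lia.
Qed.

(** The strict inequality leaves room for the middle letter of aca, whose image has length one: the
    lengths for a satisfy L' = 2L + 1. *)
Lemma size_iter_sg_gen k x : size (iter k sg [:: x]) < 2 ^ k.+1.
Proof.
have sz1 y : y <> ga -> size (iter k sg [:: y]) = 1.
  elim: k y => // k IH y ya; rewrite iterSr.
  by case: y ya => // _; apply: IH.
have sza : size (iter k sg [:: ga]) < 2 ^ k.+1.
  elim: k sz1 => // k IH sz1; rewrite iterSr.
  rewrite (iter_sg_cat k [:: ga] [:: gc; ga]) (iter_sg_cat k [:: gc] [:: ga]).
  rewrite !size_cat (_ : size (iter k sg [:: gc]) = 1); last first.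
    by have := sz1 gd; rewrite iterSr; apply.
  have : size (iter k sg [:: ga]) < 2 ^ k.+1.
    apply: IH => y; case: y => // _.
    - by have := sz1 gc; rewrite iterSr; apply.
    - by have := sz1 gd; rewrite iterSr; apply.
    - by have := sz1 gb; rewrite iterSr; apply.
  rewrite (expnS 2 k.+1); lia.
case: x => //; rewrite sz1 // expnS; have : 0 < 2 ^ k by rewrite expn_gt0.
all: lia.
Qed.

Lemma size_iter_sg k w : size (iter k sg w) <= size w * 2 ^ k.+1.
Proof.
elim: w => [|x w IH]; first by rewrite iter_sg_nil.
rewrite -cat1s iter_sg_cat !size_cat mulnDl leq_add //.
by rewrite mul1n ltnW // size_iter_sg_gen.
Qed.

Inductive base : seq gen -> Prop :=
| base_sq x : base [:: x; x]
| base_klein : base [:: gb; gc; gd]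
| base_ad : base (flatten (nseq 4 [:: ga; gd]))
| base_adacac : base (flatten (nseq 4 [:: ga; gd; ga; gc; ga; gc])).

(** The image of x is a palindrome, so that of xx is, up to signs, a word followed by its inverse.
    The images of the other base words are relators up to rotation, and all lengths are O(2^k). *)
Lemma base_cancellable : exists K, forall k r, base r ->
  cancellable (pos (iter k sg r)) (K * 2 ^ k).
Proof.
have [K1 h1] := cancellable_pair; have [K2 h2] := cancellable_relator.
(* With |sigma^k(x)| < 2^(k+1), sign flips cost at most 8 * 2^k and pairs 2 * K1 * 2^k; the longest
   base word has 24 letters, whence 48. *)
exists (8 + 2 * K1 + 48 * K2) => k r [x|||].
- rewrite (iter_sg_cat k [:: x] [:: x]); set w := iter k sg [:: x].
  have E : map fst (pos w ++ word_inv (pos w)) = map fst (pos (w ++ w)).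
    by rewrite map_cat fst_word_inv !fst_pos /w rev_iter_sg.
  apply: cancellable_le (cancellable_flips E (h1 _)).
  rewrite size_cat /word_inv size_rev !size_map.
  have := size_iter_sg_gen k x; rewrite -/w expnS; move: (2 ^ k) (size w); nia.
- apply: (@cancellable_le _ (K2 * 3)).
    have : 0 < 2 ^ k by rewrite expn_gt0.
    move: (2 ^ k); nia.
  have := iter_sg_klein k; rewrite !inE => /or3P[] /eqP ->;
    apply: (h2 (pos [:: _; _; _])) => //;
    exists (wb ++ wc ++ wd); [by constructor| |by constructor| |by constructor|];
    left; [by exists 0 | by exists 2 | by exists 1].
all: set u := flatten _; have su := leq_size_iter_sg k u.
all: apply: (@cancellable_le _ (K2 * size (pos (iter k sg u)))).
1,3: rewrite size_map; have := size_iter_sg k u; rewrite expnS;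
  rewrite [size u]/=; move: (2 ^ k) (size (iter k sg u)) => e n hn; nia.
all: apply: h2; first by move/(congr1 size); rewrite size_map => h0; rewrite h0 in su.
all: exists (pos (iter k sg u)); last by left; apply: cyclic_eq_refl.
all: by rewrite pos_iter_sg; [exact: lys_ad || exact: lys_adacac].
Qed.

(** * Derivations over positive words *)

Section Derivations.

Variable B : seq gen -> nat -> Prop.

(** Rules apply in both directions. [derives_refl] holds at every cost, which makes the cost an
    upper bound. *)
Inductive derives : seq gen -> seq gen -> nat -> Prop :=
| derives_refl u n : derives u u n
| derives_sym u v n : derives u v n -> derives v u n
| derives_trans u v w m n : derives u v m -> derives v w n -> derives u w (m + n)
| derives_rule p r q n : B r n -> derives (p ++ r ++ q) (p ++ q) n.

Lemma derives_le u v m n : m <= n -> derives u v m -> derives u v n.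
Proof. by move=> /subnKC <- /derives_trans; apply; apply: derives_refl. Qed.

Lemma derives_ctx p q u v n : derives u v n -> derives (p ++ u ++ q) (p ++ v ++ q) n.
Proof.
elim=> {u v n} [u n|u v n _|u v w m n _ IH1 _ IH2|p' r q' n Br].
- exact: derives_refl.
- exact: derives_sym.
- exact: derives_trans IH1 IH2.
- by rewrite -!catA (catA p) (catA p p'); apply: derives_rule.
Qed.

Lemma derives_cat u v u' v' m n :
  derives u v m -> derives u' v' n -> derives (u ++ u') (v ++ v') (m + n).
Proof.
move=> /(derives_ctx [::] u') h /(derives_ctx v [::]); rewrite !cats0.
exact: derives_trans h.
Qed.

Lemma derives_catl p u v n : derives u v n -> derives (p ++ u) (p ++ v) n.
Proof. by move=> /(derives_ctx p [::]); rewrite !cats0. Qed.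

Lemma derives_catr q u v n : derives u v n -> derives (u ++ q) (v ++ q) n.
Proof. exact: (derives_ctx [::]). Qed.

Definition derivable (u v : seq gen) : Prop := exists n, derives u v n.

Lemma derivable_refl u : derivable u u. Proof. by exists 0; apply: derives_refl. Qed.

Lemma derivable_sym u v : derivable u v -> derivable v u.
Proof. by case=> n /derives_sym; exists n. Qed.

Lemma derivable_trans u v w : derivable u v -> derivable v w -> derivable u w.
Proof. by move=> [m h] [n /(derives_trans h)]; exists (m + n). Qed.

Lemma derivable_ctx p q u v : derivable u v -> derivable (p ++ u ++ q) (p ++ v ++ q).
Proof. by move=> [n /(derives_ctx p q)]; exists n. Qed.

Lemma derivable_rule p r q n : B r n -> derivable (p ++ r ++ q) (p ++ q).
Proof. by exists n; apply: derives_rule. Qed.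

End Derivations.

Arguments derivable_rule [B] p [r] q [n].
Arguments derivable_ctx [B] p q [u v].

Lemma derives_mono (B B' : seq gen -> nat -> Prop) u v n :
  (forall r m, B r m -> B' r m) -> derives B u v n -> derives B' u v n.
Proof.
move=> BB'; elim=> {u v n} [u n|u v n _|u v w m n _ h1 _ h2|p r q n /BB'].
- exact: derives_refl.
- exact: derives_sym.
- exact: derives_trans h1 h2.
- exact: derives_rule.
Qed.

Definition rule0 (r : seq gen) (n : nat) : Prop := base r /\ n = 1.

(** The cost 2^k measures, up to a constant factor, the darts that [base_cancellable] spends. *)
Definition rule (r : seq gen) (n : nat) : Prop :=
  exists k r0, [/\ base r0, r = iter k sg r0 & n = 2 ^ k].

Lemma rule0_rule r n : rule0 r n -> rule r n.
Proof. by move=> [br ->]; exists 0, r. Qed.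

(** Each rule used has its exponent [k] raised by one, which doubles its cost. *)
Lemma derives_sg u v n : derives rule u v n -> derives rule (sg u) (sg v) (n + n).
Proof.
elim=> {u v n} [u n|u v n _|u v w m n _ h1 _ h2|p r q n [k [r0 [b -> ->]]]].
- exact: derives_refl.
- exact: derives_sym.
- by rewrite addnACA; apply: derives_trans h1 h2.
- rewrite !sg_cat; apply: derives_rule; exists k.+1, r0.
  by rewrite expnS mul2n addnn.
Qed.

(** The nonempty tail [s] keeps every intermediate boundary nonempty, even when a derivation passes
    through the empty word. *)
Lemma derives_disc : exists K, forall u v n, derives rule u v n ->
  forall s M, s <> [::] ->
    (disc lysenok (pos v ++ s) M -> disc lysenok (pos u ++ s) (M + K * n)) /\
    (disc lysenok (pos u ++ s) M -> disc lysenok (pos v ++ s) (M + K * n)).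
Proof.
have [K hK] := base_cancellable; exists K => u v n.
elim=> {u v n} [u n|u v n _ IH|u v w m n _ h1 _ h2|p r q n [k [r0 [b -> ->]]]] s M s0.
- by split; apply: disc_le; rewrite leq_addr.
- by have [] := IH s M s0.
- split.
    move=> /(proj1 (h2 s M s0)) /(proj1 (h1 s _ s0)).
    by apply: disc_le; rewrite mulnDr; lia.
  move=> /(proj2 (h1 s M s0)) /(proj2 (h2 s _ s0)).
  by apply: disc_le; rewrite mulnDr; lia.
- have [h1 h2] := hK k r0 b; rewrite !pos_cat -!catA; split; first exact: h1.
  by apply: h2; case: s s0 => //; case: (pos p) => //; case: (pos q).
Qed.

(** * Normal forms and derivations checked by computation *)

Definition push (x : gen) (w : seq gen) : seq gen :=
  match w with
  | [::] => [:: x]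
  | y :: w' =>
    match x, y with
    | ga, ga | gb, gb | gc, gc | gd, gd => w'
    | gb, gc | gc, gb => gd :: w'
    | gb, gd | gd, gb => gc :: w'
    | gc, gd | gd, gc => gb :: w'
    | _, _ => x :: w
    end
  end.

(* The normal form in the free product of <a> and {1, b, c, d}. *)
Definition nf (w : seq gen) : seq gen := foldr push [::] w.

Lemma base_derivable r : base r -> derivable rule0 r [::].
Proof.
move=> b; have b0 : rule0 r 1 by [].
by have := derivable_rule [::] [::] b0; rewrite cats0.
Qed.

Lemma derivable_klein p x y z q : klein x y z ->
  derivable rule0 (p ++ [:: x; y] ++ q) (p ++ [:: z] ++ q).
Proof.
have sq w p' q' : derivable rule0 (p' ++ [:: w; w] ++ q') (p' ++ q').
  by apply: (@derivable_rule rule0 _ _ _ 1); split => //; apply: base_sq.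
have bcd p' q' : derivable rule0 (p' ++ [:: gb; gc; gd] ++ q') (p' ++ q').
  by apply: (@derivable_rule rule0 _ _ _ 1); split => //; apply: base_klein.
move=> xyz; apply: derivable_ctx.
have bc : derivable rule0 [:: gb; gc] [:: gd].
  apply: derivable_trans (bcd [::] [:: gd]).
  by apply: derivable_sym; apply: (sq gd [:: gb; gc] [::]).
have cd : derivable rule0 [:: gc; gd] [:: gb].
  apply: derivable_trans (bcd [:: gb] [::]).
  by apply: derivable_sym; apply: (sq gb [::] [:: gc; gd]).
have cb : derivable rule0 [:: gc; gb] [:: gd].
  apply: derivable_trans (derivable_sym (bcd [:: gc; gb] [::])) _.
  apply: derivable_trans (sq gb [:: gc] [:: gc; gd]) _.
  exact: (sq gc [::] [:: gd]).
have dc : derivable rule0 [:: gd; gc] [:: gb].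
  apply: derivable_trans (derivable_sym (sq gb [:: gd; gc] [::])) _.
  apply: derivable_trans (derivable_ctx [:: gd] [:: gb] cb) _.
  exact: (sq gd [::] [:: gb]).
have bd : derivable rule0 [:: gb; gd] [:: gc].
  apply: derivable_trans (derivable_ctx [:: gb] [::] (derivable_sym bc)) _.
  exact: (sq gb [::] [:: gc]).
have db : derivable rule0 [:: gd; gb] [:: gc].
  apply: derivable_trans (derivable_ctx [::] [:: gb] (derivable_sym cb)) _.
  exact: (sq gb [:: gc] [::]).
by case: x y z xyz => [] [] [].
Qed.

Lemma derives_nf : exists K, forall w, derives rule0 w (nf w) (K * size w).
Proof.
have [K hK] : exists K, forall xy : gen * gen,
    derives rule0 [:: xy.1; xy.2] (push xy.1 [:: xy.2]) K.
  apply: fin_bound => [x m n|[x y]]; first exact: derives_le.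
  have := @derivable_klein [::] x y _ [::].
  by case: x y => [] [] /= h;
    first [exact: derivable_refl | exact: base_derivable (base_sq _) | apply: h].
exists K; elim=> [|x w IH]; first exact: derives_refl.
rewrite /= mulnS addnC; apply: derives_trans (derives_catl [:: x] IH) _.
case: (nf w) => [|y w'] /=; first exact: derives_refl.
have := derives_catr w' (hK (x, y)); move: K {hK IH} => K.
by case: x y => [] [].
Qed.

Section Certificates.

Variable B : seq gen -> nat -> Prop.
Hypothesis B0 : forall r n, rule0 r n -> B r n.

Lemma derivable_nf u : derivable B u (nf u).
Proof.
by have [K /(_ u)/(derives_mono B0)] := derives_nf; exists (K * size u).
Qed.

Lemma derivable_eq_nf u v : nf u = nf v -> derivable B u v.
Proof.
move=> E; apply: derivable_trans (derivable_nf u) _; rewrite E.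
exact/derivable_sym/derivable_nf.
Qed.

(** [rev q] is an inverse of [q] because letters are involutions. Combined with [derivable_eq_nf],
    it certifies a derivation by listing the conjugated relators to insert. *)
Lemma derivable_insert q r n u v :
  B r n -> derivable B (u ++ rev q ++ r ++ q) v -> derivable B u v.
Proof.
move=> Br; apply: derivable_trans.
have h0 : derivable B (u ++ rev q ++ q) u.
  elim: q => [|x q IH]; first by rewrite !cats0; apply: derivable_refl.
  apply: derivable_trans IH; rewrite rev_cons -cats1 -catA !(catA u).
  apply: (@derivable_rule B (u ++ rev q) [:: x; x] q 1); apply: B0; split => //.
  exact: base_sq.
apply: derivable_trans (derivable_sym h0) _; rewrite !(catA u).
by apply/derivable_sym/(derivable_rule (u ++ rev q) q Br).
Qed.

End Certificates.

(** * The action on the binary tree *)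

(** The standard generators of the Grigorchuk group: b = (a, c), c = (a, d), d = (1, b), the first
    coordinate being at [false]. *)
Fixpoint act (g : gen) (s : seq bool) : seq bool :=
  match s with
  | [::] => [::]
  | x :: s' =>
    match g with
    | ga => ~~ x :: s'
    | gb => x :: act (if x then gc else ga) s'
    | gc => x :: act (if x then gd else ga) s'
    | gd => x :: if x then act gb s' else s'
    end
  end.

Definition actw (w : seq gen) (s : seq bool) : seq bool :=
  foldl (fun t g => act g t) s w.

Definition acts_trivially (w : seq gen) : Prop := forall s, actw w s = s.

Lemma actw_cat u v s : actw (u ++ v) s = actw v (actw u s).
Proof. exact: foldl_cat. Qed.

Lemma act_sq g s : act g (act g s) = s.
Proof.
elim: s g => [|x s IH] [] //=; rewrite ?negbK //; case: x => /=;
  by rewrite ?IH.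
Qed.

Lemma derives_act (B : seq gen -> nat -> Prop) u v n :
  (forall r m, B r m -> acts_trivially r) -> derives B u v n -> actw u =1 actw v.
Proof.
move=> BT; elim=> {u v n} // [u v n _ IH s|u v w m n _ h1 _ h2 s|p r q n /BT h s].
- by rewrite IH.
- by rewrite h1 h2.
- by rewrite !actw_cat h.
Qed.

Definition is_a (x : gen) : bool := if x is ga then true else false.

(* The section of w at the letter x, for the right action [actw]. *)
Fixpoint sec (x : bool) (w : seq gen) : seq gen :=
  match w with
  | [::] => [::]
  | ga :: w' => sec (~~ x) w'
  | gb :: w' => (if x then gc else ga) :: sec x w'
  | gc :: w' => (if x then gd else ga) :: sec x w'
  | gd :: w' => if x then gb :: sec x w' else sec x w'
  end.

Lemma actw_cons w x s :
  actw w (x :: s) = (x (+) odd (count is_a w)) :: actw (sec x w) s.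
Proof.
elim: w x s => [|g w IH] x s; first by rewrite addbF.
rewrite /actw /= -!/(actw _ _); case: g; rewrite /= IH ?add0n //.
  by rewrite addbN addNb.
by case: x.
Qed.

Lemma sec_cat x u v :
  sec x (u ++ v) = sec x u ++ sec (x (+) odd (count is_a u)) v.
Proof.
elim: u x => [|g u IH] x /=; first by rewrite addbF.
by case: g; rewrite ?IH /= ?add0n ?addbN ?addNb //; case: x; rewrite ?IH.
Qed.

Lemma size_sec x w : size (sec x w) <= count (predC is_a) w.
Proof.
elim: w x => // g w IH x; case: g => /=; rewrite ?add0n ?add1n ?ltnS ?IH //.
by case: x; rewrite /= ?ltnS ?IH // ltnW // ltnS.
Qed.

Lemma acts_trivially_even w : acts_trivially w -> odd (count is_a w) = false.
Proof.
by move=> /(_ [:: false]); rewrite actw_cons => -[]; case: odd.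
Qed.

Lemma acts_trivially_sec x w : acts_trivially w -> acts_trivially (sec x w).
Proof. by move=> h s; have := h (x :: s); rewrite actw_cons => -[]. Qed.

Lemma acts_nontrivially_gen g : ~ acts_trivially [:: g].
Proof.
move=> h; case: g h => h.
- by have := h [:: false].
- by have := h [:: false; false].
- by have := h [:: false; false].
- by have := h [:: true; false; false].
Qed.

Lemma base_acts_trivially r : base r -> acts_trivially r.
Proof.
case=> [x s||[//|[] s]|[//|[] s]].
- exact: act_sq.
(* The section of bcd at [true] is cdb, so the three rotations are treated together. *)
- suff h s : [/\ actw [:: gb; gc; gd] s = s, actw [:: gc; gd; gb] s = s &
                 actw [:: gd; gb; gc] s = s] by move=> s; case: (h s).
  elim: s => [//|x s]; rewrite /actw /= => -[h1 h2 h3].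
  by case: x => /=; rewrite ?h1 ?h2 ?h3 ?act_sq.
all: by rewrite actw_cons /= /actw /= !act_sq.
Qed.

(* The dihedral group of order 8, as upper unitriangular 3 x 3 matrices over
   the field with two elements. *)
Definition dih : Type := (bool * bool * bool)%type.

Definition dih_mul (g h : dih) : dih :=
  let: (x, y, z) := g in let: (x', y', z') := h in
  (x (+) x', y (+) y', z (+) z' (+) (x && y')).

Definition dih1 : dih := (false, false, false).
Definition dih_a : dih := (true, false, false).
Definition dih_d : dih := (false, true, false).

Lemma dih_mulA g h k : dih_mul g (dih_mul h k) = dih_mul (dih_mul g h) k.
Proof. by move: g h k => [[[] []] []] [[[] []] []] [[[] []] []]. Qed.

Lemma dih_mul1 g : dih_mul g dih1 = g.
Proof. by move: g => [[[] []] []]. Qed.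

Lemma dih_1mul g : dih_mul dih1 g = g.
Proof. by move: g => [[[] []] []]. Qed.

Lemma dih_exp4 g : dih_mul g (dih_mul g (dih_mul g g)) = dih1.
Proof. by move: g => [[[] []] []]. Qed.

Definition dval (h : gen -> dih) (w : seq gen) : dih :=
  foldr (fun x => dih_mul (h x)) dih1 w.

Lemma dval_cat h u v : dval h (u ++ v) = dih_mul (dval h u) (dval h v).
Proof. by elim: u => [|x u /= ->]; rewrite ?dih_1mul ?dih_mulA. Qed.

Lemma dval_sg h w : dval h (sg w) = dval (fun x => dval h (sg_gen x)) w.
Proof. by elim: w => //= x w <-; rewrite -dval_cat. Qed.

(** Composing [h] with sigma preserves its two hypotheses, so induction on [k] reduces to base
    words, where fourth powers vanish in the dihedral group of order 8. *)
Lemma dval_base h r : (forall x, dih_mul (h x) (h x) = dih1) ->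
  dih_mul (h gb) (dih_mul (h gc) (h gd)) = dih1 ->
  base r -> forall k, dval h (iter k sg r) = dih1.
Proof.
move=> h2 h3 br k; elim: k h h2 h3 => [|k IH] h h2 h3.
  have exp4 u : dval h (flatten (nseq 4 u)) = dih1.
    by rewrite /= !dval_cat dih_mul1 dih_exp4.
  by case: br => [x|||]; [| |exact: exp4|exact: exp4];
    rewrite /= dih_mul1 ?h2 ?h3.
rewrite dval_sg; apply: IH => [[]|] /=; rewrite !dih_mul1 ?h2 //.
  by rewrite -!dih_mulA (dih_mulA (h ga) (h ga)) h2 dih_1mul
    (dih_mulA (h gc)) h2 dih_1mul h2.
have -> : h gd = dih_mul (h gc) (h gb).
  have E : dih_mul (h gc) (h gd) = h gb.
    by rewrite -[LHS]dih_1mul -(h2 gb) -dih_mulA h3 dih_mul1.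
  by rewrite -E dih_mulA h2 dih_1mul.
by rewrite -dih_mulA (dih_mulA (h gb)) h2 dih_1mul h2.
Qed.

(* The section of sg x at [false]; the section at [true] is x itself. *)
Definition pg (x : gen) : seq gen :=
  match x with ga => [:: gd] | gb => [::] | gc => [:: ga] | gd => [:: ga] end.

Definition pw (w : seq gen) : seq gen := flatten (map pg w).

Lemma pw_cat u v : pw (u ++ v) = pw u ++ pw v.
Proof. by rewrite /pw map_cat flatten_cat. Qed.

(** The class of [pw w] in the dihedral group <a, d>. *)
Definition pval : seq gen -> dih :=
  dval (fun x => match x with ga => dih_d | gb => dih1 | gc | gd => dih_a end).

Definition dih_rep (g : dih) : seq gen :=
  let: (x, y, z) := g in
  (if z then [:: ga; gd; ga; gd] else [::]) ++
  (if y then [:: gd] else [::]) ++ (if x then [:: ga] else [::]).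

(** Letters are absorbed one at a time into a fixed representative of the class: finitely many
    cases, hence linear cost. *)
Lemma derives_rep : exists K, forall w,
  derives rule0 (pw w) (dih_rep (pval w)) (K * size w).
Proof.
have rule0_ad : rule0 (flatten (nseq 4 [:: ga; gd])) 1 by split=> //; constructor.
have id0 r n : rule0 r n -> rule0 r n by [].
have [K hK] : exists K, forall gx : dih * gen,
    derives rule0 (dih_rep gx.1 ++ pg gx.2) (dih_rep (dih_mul gx.1 (pval [:: gx.2]))) K.
  apply: fin_bound => [gx m n|[g x]]; first exact: derives_le.
  rewrite /= dih_mul1 -/(derivable _ _ _).
  by case: g x => [[[] []] []] [];
    first [ exact: (derivable_eq_nf id0)
          | apply: (@derivable_insert _ id0 [:: ga] _ 1 _ _ rule0_ad); exact: (derivable_eq_nf id0)].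
exists K; elim/last_ind => [|w x IH]; first exact: derives_refl.
rewrite size_rcons mulnS addnC -cats1 pw_cat /pval dval_cat -/pval.
apply: derives_trans (derives_catr _ IH) _.
by have := hK (pval w, x); rewrite /pw /= cats0.
Qed.

Lemma sec_sg w : [/\ sec true (sg w) = w, sec false (sg w) = pw w &
                     odd (count is_a (sg w)) = false].
Proof.
elim: w => //= x w [h1 h2 h3]; rewrite -cat1s sg_cat.
by case: x; rewrite /= ?h1 ?h2 ?h3.
Qed.

Lemma sg_acts_trivially w : acts_trivially w -> acts_trivially (pw w) ->
  acts_trivially (sg w).
Proof.
move=> h1 h2 [|x s] /=; first by elim: (sg w) => //= g u; case: g.
by have [E1 E2 E3] := sec_sg w; rewrite actw_cons E3 addbF; case: x; rewrite ?E1 ?E2 ?h1 ?h2.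
Qed.

Lemma pval1_acts_trivially w : pval w = dih1 -> acts_trivially (pw w).
Proof.
move=> E; have [K /(_ w)] := derives_rep; rewrite E => /derives_act; apply.
by move=> r m [/base_acts_trivially].
Qed.

Lemma pval_rule r n : rule r n -> pval r = dih1.
Proof. by move=> [k [r0 [b -> _]]]; apply: dval_base => //; case. Qed.

(** The sections of sigma(w) are w and p(w). The first is trivial by induction, the second because
    [pval] kills every rule. *)
Lemma rule_acts_trivially r n : rule r n -> acts_trivially r.
Proof.
move=> [k [r0 [b -> _]]]; elim: k => [|k IH]; first exact: base_acts_trivially.
apply: sg_acts_trivially => //; apply: pval1_acts_trivially.
by apply: (@pval_rule _ (2 ^ k)); exists k, r0.
Qed.

Lemma derives_pval u v n : derives rule u v n -> pval u = pval v.
Proof.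
elim=> {u v n} // [u v w m n _ -> _ -> //|p r q n /pval_rule E].
by rewrite /pval !dval_cat -/pval E dih_1mul.
Qed.

Lemma lysenok_acts_trivially r : lysenok r -> acts_trivially (map fst r).
Proof.
have h k r0 : base r0 -> acts_trivially (map fst (iter k sigma (pos r0))).
  move=> b; rewrite -pos_iter_sg fst_pos; apply: (@rule_acts_trivially _ (2 ^ k)).
  by exists k, r0.
case=> [||||| k|k]; try exact: (base_acts_trivially (base_sq _)).
- exact: (base_acts_trivially base_klein).
- exact: (h k _ base_ad).
- exact: (h k _ base_adacac).
Qed.

Lemma actw_sq w s : actw (w ++ rev w) s = s.
Proof.
elim: w s => // x w IH s.
have -> : (x :: w) ++ rev (x :: w) = [:: x] ++ ((w ++ rev w) ++ [:: x]).
  by rewrite rev_cons -cats1 /= catA.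
by rewrite actw_cat actw_cat IH /actw /= act_sq.
Qed.

Lemma acts_trivially_rev w : acts_trivially w -> acts_trivially (rev w).
Proof. by move=> h s; have := actw_sq w s; rewrite actw_cat h. Qed.

(** Membership in the normal closure enters the bound only through this consequence. *)
Lemma normal_closure_acts_trivially W :
  normal_closure lysenok W -> acts_trivially (map fst W).
Proof.
elim=> {W} [r|s|u v _ h1 _ h2 s|u _ h|u g _ h s|u v uv _ h s].
- exact: lysenok_acts_trivially.
- by [].
- by rewrite map_cat actw_cat h1 h2.
- by rewrite fst_word_inv; apply: acts_trivially_rev.
- by rewrite !map_cat fst_word_inv !actw_cat h -actw_cat actw_sq.
rewrite -{2}(h s); elim: uv s {h} => {u v} // [u v l s|u v w _ IH1 _ IH2 s].
- by rewrite !map_cat !actw_cat /= /actw /= act_sq.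
- by rewrite IH2 IH1.
Qed.

(** * Recursion through the sections *)

Definition conj_index : Type := (bool * bool)%type.

(* The four conjugates of b by the dihedral group <a, d>. *)
Definition bconj (i : conj_index) : seq gen :=
  match i with
  | (false, false) => [:: gb]
  | (false, true) => [:: ga; gb; ga]
  | (true, false) => [:: gd; ga; gb; ga; gd]
  | (true, true) => [:: ga; gd; ga; gb; ga; gd; ga]
  end.

(* Conjugates of ada under sigma-images, with sections (bconj i, 1). *)
Definition dconj (i : conj_index) : seq gen :=
  match i with
  | (false, false) => [:: ga; gd; ga]
  | (false, true) => [:: gc; ga; gd; ga; gc]
  | (true, false) => [:: ga; gc; ga; gc; ga; gd; ga; gc; ga; gc; ga]
  | (true, true) =>
    [:: gc; ga; gc; ga; gc; ga; gd; ga; gc; ga; gc; ga; gc]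
  end.

(** The effect of conjugation by p(x) on the four conjugates: p(a) = d exchanges the two bits, while
    p(c) = p(d) = a flips the second. *)
Definition conj_move (x : gen) (i : conj_index) : conj_index :=
  match x with
  | ga => (i.2, i.1)
  | gb => i
  | gc | gd => (i.1, ~~ i.2)
  end.

(** The same move of indices describes sigma(x) acting on conjugates of ada and p(x) acting on
    conjugates of b. It is a finite check with the relators below. *)
Lemma conj_move_gen : exists K, forall x i,
  derives rule (sg_gen x ++ dconj i) (dconj (conj_move x i) ++ sg_gen x) K /\
  derives rule (pg x ++ bconj i) (bconj (conj_move x i) ++ pg x) K.
Proof.
have r_ad : rule (flatten (nseq 4 [:: ga; gd])) 1.
  by apply: rule0_rule; split=> //; constructor.
have r_x : rule (flatten (nseq 4 [:: ga; gd; ga; gc; ga; gc])) 1.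
  by apply: rule0_rule; split=> //; constructor.
(* As sigma(ad) = acac, this is sigma((ad)^4), of cost 2^1. *)
have r_ac : rule (flatten (nseq 4 [:: ga; gc; ga; gc])) 2.
  by exists 1, (flatten (nseq 4 [:: ga; gd])); split => //; constructor.
have ins q r n u v := @derivable_insert rule rule0_rule q r n u v.
have [K hK] : exists K, forall xi : gen * conj_index,
    derives rule (sg_gen xi.1 ++ dconj xi.2) (dconj (conj_move xi.1 xi.2) ++ sg_gen xi.1) K.
  apply: fin_bound => [xi m n|[x i]]; first exact: derives_le.
  case: x i => [] [[] []]; rewrite /= -/(derivable _ _ _);
    first
    [ exact: (derivable_eq_nf rule0_rule)
    | apply: (ins [::] _ _ _ _ r_ad); exact: (derivable_eq_nf rule0_rule)
    | apply: (ins [:: ga; gb] _ _ _ _ r_ad); exact: (derivable_eq_nf rule0_rule)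
    | apply: (ins [:: ga; gd] _ _ _ _ r_x); exact: (derivable_eq_nf rule0_rule)
    | apply: (ins [:: ga; gb] _ _ _ _ r_x); exact: (derivable_eq_nf rule0_rule)
    | apply: (ins [:: ga; gb; ga; gc; ga; gc; ga; gc] _ _ _ _ r_ac);
      apply: (ins [:: ga] _ _ _ _ r_ac); exact: (derivable_eq_nf rule0_rule)].
have [L hL] : exists K, forall xi : gen * conj_index,
    derives rule (pg xi.1 ++ bconj xi.2) (bconj (conj_move xi.1 xi.2) ++ pg xi.1) K.
  apply: fin_bound => [xi m n|[x i]]; first exact: derives_le.
  case: x i => [] [[] []]; rewrite /= -/(derivable _ _ _);
    first
    [ exact: (derivable_eq_nf rule0_rule)
    | apply: (ins [:: gb; ga; gd; ga] _ _ _ _ r_ad);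
      apply: (ins [::] _ _ _ _ r_ad); exact: (derivable_eq_nf rule0_rule)].
exists (K + L) => x i; split.
  exact: derives_le (leq_addr _ _) (hK (x, i)).
exact: derives_le (leq_addl _ _) (hL (x, i)).
Qed.

Lemma conj_move_word : exists K, forall s i, exists j,
  derives rule (sg s ++ dconj i) (dconj j ++ sg s) (K * size s) /\
  derives rule (pw s ++ bconj i) (bconj j ++ pw s) (K * size s).
Proof.
have [K hK] := conj_move_gen; exists K => s i; elim: s => [|x s [j [h1 h2]]].
  by exists i; rewrite muln0 /= !cats0; split; apply: derives_refl.
have [h3 h4] := hK x j; exists (conj_move x j); rewrite [size _]/= mulnS addnC.
change (sg (x :: s)) with (sg_gen x ++ sg s).
change (pw (x :: s)) with (pg x ++ pw s); rewrite -!catA.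
split.
  apply: derives_trans (derives_catl _ h1) _; rewrite !catA.
  exact: derives_catr.
apply: derives_trans (derives_catl _ h2) _; rewrite !catA.
exact: derives_catr.
Qed.

Definition dconjs (I : seq conj_index) : seq gen := flatten (map dconj I).
Definition bconjs (I : seq conj_index) : seq gen := flatten (map bconj I).

Lemma dconjs_rcons I i : dconjs (rcons I i) = dconjs I ++ dconj i.
Proof. by rewrite /dconjs map_rcons flatten_rcons. Qed.

Lemma bconjs_rcons I i : bconjs (rcons I i) = bconjs I ++ bconj i.
Proof. by rewrite /bconjs map_rcons flatten_rcons. Qed.

(** Built letter by letter from the left. The same [I] serves both derivations because
    [conj_move_word] gives a common new index; each letter costs O(|u|), hence the square. *)
Lemma sections_decomposition : exists K, forall u, exists I : seq conj_index,
  [/\ size I <= size u,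
      derives rule u (dconjs I ++ sg (sec true u) ++
        (if odd (count is_a u) then [:: ga] else [::])) (K * size u ^ 2) &
      derives rule (sec false u) (bconjs I ++ pw (sec true u)) (K * size u ^ 2)].
Proof.
have [K0 h0] := conj_move_word.
have eqn := derivable_eq_nf rule0_rule.
have [n1 h1] := eqn [:: ga; ga] [::] erefl.
have [n2 h2] := eqn [:: ga; gb] [:: ga; gd; ga; ga; gc; ga; ga] erefl.
have [n3 h3] := eqn [:: ga; gc] [:: ga; gc; ga; ga] erefl.
have [n4 h4] := eqn [:: ga; gd] [:: ga; gd; ga; ga] erefl.
have [n5 h5] := eqn [:: gc] [:: gb; gd] erefl.
pose c := n1 + n2 + n3 + n4 + n5; exists (K0 + c).
elim/last_ind => [|u y [I [sI IH1 IH2]]].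
  by exists [::]; split=> //; apply: derives_refl.
set s := sec true u in IH1 IH2 *.
have ss : size s <= size u.
  by apply: leq_trans (size_sec _ _) _; apply: count_size.
have cost m : m <= K0 * size u + c ->
    (K0 + c) * size u ^ 2 + m <= (K0 + c) * size (rcons u y) ^ 2.
  by rewrite size_rcons; nia.
have K0s : K0 * size s <= K0 * size u by rewrite leq_mul.
have done1 v m : m <= K0 * size u + c ->
  derives rule (dconjs I ++ sg s ++ (if odd (count is_a u) then [:: ga] else [::]) ++ [:: y]) v m ->
  derives rule (rcons u y) v ((K0 + c) * size (rcons u y) ^ 2).
  move=> /cost le h; apply: derives_le le _; rewrite -cats1.
  by apply: derives_trans (derives_catr _ IH1) _; rewrite -!catA.
have done2 v m : m <= K0 * size u + c ->
  derives rule (bconjs I ++ pw s ++ sec (odd (count is_a u)) [:: y]) v m ->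
  derives rule (sec false (rcons u y)) v ((K0 + c) * size (rcons u y) ^ 2).
  move=> /cost le h; apply: derives_le le _; rewrite -cats1 sec_cat addFb.
  by apply: derives_trans (derives_catr _ IH2) _; rewrite -!catA.
have secE : sec true (rcons u y) = s ++ sec (~~ odd (count is_a u)) [:: y].
  by rewrite -cats1 sec_cat addTb.
have parE : odd (count is_a (rcons u y)) = odd (count is_a u) (+) is_a y.
  by rewrite -cats1 count_cat oddD /= addn0; case: (is_a y).
have sI' : size I <= size (rcons u y) by rewrite size_rcons ltnW // ltnS.
have le0 : 0 <= K0 * size u + c by [].
have [j [hj1 hj2]] := h0 s (false, false).
have sJ : size (rcons I j) <= size (rcons u y) by rewrite !size_rcons ltnS.
(* After an even number of a's, a letter other than a equals sigma of its section at [true], and p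
   of that section is its section at [false]: both derivations cost nothing. *)
rewrite secE parE; case: (odd _) done1 done2 => done1 done2; last first.
  by exists I; split=> //; case: y {cost secE parE sI' sJ} done1 done2 => done1 done2;
    [ apply: (done1 _ 0) | apply: (done1 _ 0) | apply: (done1 _ 0)
    | apply: (done1 _ 0) | apply: (done2 _ 0) | apply: (done2 _ 0)
    | apply: (done2 _ 0) | apply: (done2 _ 0)] => //;
    rewrite ?sg_cat ?pw_cat -?catA; apply: derives_refl.
(* After an odd number of a's, with D = ada: ab = D sigma(a) a, ac = sigma(a) a and ad = D a. Each D
   is moved left across sigma(s), and the matching b across p(s). *)
case: y {cost secE parE} sI' sJ done1 done2 => sI' sJ done1 done2.
- exists I; split=> //.
    apply: (done1 _ n1); first by rewrite /c; lia.
    rewrite sg_cat -catA; exact: (derives_catl _ (derives_catl _ h1)).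
  by apply: (done2 _ 0) => //; rewrite pw_cat; apply: derives_refl.
- exists (rcons I j); split=> //.
    apply: (done1 _ (n2 + K0 * size s)); first by rewrite /c; lia.
    rewrite dconjs_rcons sg_cat; apply: derives_trans (derives_catl _ (derives_catl _ h2)) _.
    by have := derives_ctx (dconjs I) [:: ga; gc; ga; ga] hj1; rewrite -!catA.
  apply: (done2 _ (n5 + K0 * size s)); first by rewrite /c; lia.
  rewrite bconjs_rcons pw_cat; apply: derives_trans (derives_catl _ (derives_catl _ h5)) _.
  by have := derives_ctx (bconjs I) [:: gd] hj2; rewrite -!catA.
- exists I; split=> //.
    apply: (done1 _ n3); first by rewrite /c; lia.
    rewrite sg_cat -catA; exact: (derives_catl _ (derives_catl _ h3)).
  by apply: (done2 _ 0) => //; rewrite pw_cat; apply: derives_refl.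
- exists (rcons I j); split=> //.
    apply: (done1 _ (n4 + K0 * size s)); first by rewrite /c; lia.
    rewrite dconjs_rcons sg_cat; apply: derives_trans (derives_catl _ (derives_catl _ h4)) _.
    by have := derives_ctx (dconjs I) [:: ga] hj1; rewrite -!catA.
  apply: (done2 _ (K0 * size s)); first by rewrite /c; lia.
  rewrite bconjs_rcons pw_cat -catA; apply: derives_catl.
  by rewrite cats0.
Qed.

(** Each [dconj i] has the normal form of a sigma([bconj i]) a, and the inner pairs aa cancel. *)
Lemma dconjs_bconjs : exists K, forall I,
  derives rule (dconjs I) ([:: ga] ++ sg (bconjs I) ++ [:: ga]) (K * (size I).+1).
Proof.
have [K hK] : exists K, forall i : conj_index,
    derives rule (dconj i) ([:: ga] ++ sg (bconj i) ++ [:: ga]) K.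
  apply: fin_bound => [i m n|i]; first exact: derives_le.
  rewrite -/(derivable _ _ _); case: i => [[] []]; exact: (derivable_eq_nf rule0_rule).
have [n h] := derivable_eq_nf rule0_rule (erefl : nf [:: ga; ga] = nf [::]).
exists (K + n); elim=> [|i I IH].
  by apply: derives_le (derives_sym h); lia.
have -> : (K + n) * (size (i :: I)).+1 = n + (K + (K + n) * (size I).+1) by rewrite /=; lia.
change (dconjs (i :: I)) with (dconj i ++ dconjs I).
change (bconjs (i :: I)) with (bconj i ++ bconjs I); rewrite sg_cat.
rewrite addnC; apply: derives_trans (derives_cat (hK i) IH) _.
by have := derives_ctx ([:: ga] ++ sg (bconj i)) (sg (bconjs I) ++ [:: ga]) h; rewrite -!catA.
Qed.

(** Trivialising the section at [true] makes its p-image trivial in <a, d>, so [bconjs I] inherits a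
    trivialisation from the section at [false]. Applying sigma to both trivialisations doubles their
    costs. *)
Lemma lift_sections : exists K, forall W m n, odd (count is_a W) = false ->
  derives rule (sec true W) [::] m -> derives rule (sec false W) [::] n ->
  derives rule W [::] (K * (size W).+1 ^ 2 + m.*2 + n.*2).
Proof.
have [K1 h1] := sections_decomposition; have [K2 h2] := derives_rep.
have [K3 h3] := dconjs_bconjs.
have [n0 haa] := derivable_eq_nf rule0_rule (erefl : nf [:: ga; ga] = nf [::]).
exists (3 * K1 + 2 * K2 + K3 + n0) => W m n even hm hn.
have [I [sI d1 d2]] := h1 W; rewrite even cats0 in d1.
have sW : size (sec true W) <= size W.
  by apply: leq_trans (size_sec _ _) _; apply: count_size.
have hp : derives rule (pw (sec true W)) [::] (K2 * size W).
  have := derives_mono rule0_rule (h2 (sec true W)).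
  rewrite (derives_pval hm) => /derives_le; apply.
  by rewrite leq_mul.
have hb : derives rule (bconjs I) [::] (K2 * size W + (K1 * size W ^ 2 + n)).
  have := derives_catl (bconjs I) (derives_sym hp); rewrite cats0.
  move/derives_trans; apply; exact: derives_trans (derives_sym d2) hn.
have hd : derives rule (dconjs I) [::]
    (K3 * (size I).+1 + ((K2 * size W + (K1 * size W ^ 2 + n)).*2 + n0)).
  apply: derives_trans (h3 I) _; rewrite -addnn.
  apply: derives_trans (derives_ctx [:: ga] [:: ga] (derives_sg hb)) _.
  exact: haa.
have := derives_trans d1 (derives_cat hd (derives_sg hm)).
apply: derives_le; rewrite -!addnn; move: (size W) (size I) sI => w i sI; nia.
Qed.

(** * Halving of lengths and the recursive bound *)

Definition alternating (w : seq gen) : bool :=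
  sorted (fun x y => is_a x (+) is_a y) w.

Lemma nf_alternating w : alternating (nf w).
Proof.
elim: w => //= x w; case: (nf w) => [|y [|z u]] //=; case: x => //; case: y => //;
  case: z => //=.
Qed.

Lemma size_nf w : size (nf w) <= size w.
Proof.
elim: w => //= x w IH; apply: leq_trans (_ : (size (nf w)).+1 <= _) => //.
by case: (nf w) => [|y u] //=; case: x; case: y => //=; lia.
Qed.

Lemma alternating_count w :
  alternating w -> (count (predC is_a) w).*2 <= (size w).+1.
Proof.
suff h x u : path (fun x y => is_a x (+) is_a y) x u ->
    (count (predC is_a) (x :: u)).*2 <= (size u).+1 + ~~ is_a x.
  by case: w => // x u /h /leq_trans; apply; rewrite /=; case: (is_a x); lia.
elim: u x => [|y u IH] x /=; first by case: x.
by move=> /andP[xy /IH /=]; move: xy; case: (is_a x); case: (is_a y) => //= _; lia.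
Qed.

(** Normal form followed by sections brings |W| down to at most (|W| + 1)/2, so |W| - 1 is at least
    halved; hence the forms [(2 ^ k).+1] and [(size W).-1]. Each level adds K (|W| - 1)^2. *)
Lemma quasi_quadratic : exists K, forall k W, acts_trivially W ->
  size W <= (2 ^ k).+1 -> derives rule W [::] (K * k.+1 * (size W).-1 ^ 2).
Proof.
have [K1 h1] := derives_nf; have [K2 h2] := lift_sections.
have halve W T : acts_trivially W ->
    (forall W', acts_trivially W' -> (size W').*2 <= (size W).+1 ->
       derives rule W' [::] T) ->
    derives rule W [::] (K1 * size W + (K2 * (size W).+1 ^ 2 + 4 * T)).
  move=> triv hT; have triv' : acts_trivially (nf W).
    move=> s; rewrite -{2}(triv s); symmetry; apply: derives_act (h1 W) s.
    by move=> r m [/base_acts_trivially].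
  have hs x : derives rule (sec x (nf W)) [::] T.
    apply: hT; first exact: acts_trivially_sec.
    apply: leq_trans (_ : (size (nf W)).+1 <= _); last by rewrite ltnS size_nf.
    apply: leq_trans (alternating_count (nf_alternating W)).
    by rewrite leq_double size_sec.
  apply: derives_trans (derives_mono rule0_rule (h1 W)) _.
  apply: derives_le (h2 _ _ _ (acts_trivially_even triv') (hs true) (hs false)).
  have := size_nf W; rewrite -!addnn; move: (size _) (size _) => m n; nia.
have small W : acts_trivially W -> size W <= 1 -> W = [::].
  by case: W => [//|x [|//]] /acts_nontrivially_gen.
(* With m = |W| - 1 >= 1, one has m + 1 <= 2 m^2 and (m + 2)^2 <= 9 m^2. *)
exists (2 * K1 + 9 * K2); set K := 2 * K1 + 9 * K2 => k.
elim: k => [|k IH] W triv sW.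
  (* Here |W| <= 2, so the sections have length at most one; acting trivially, they are empty and
     cost 0. *)
  case: (leqP (size W) 1) => [/(small _ triv) ->|W1]; first exact: derives_refl.
  apply: (derives_le _ (halve W 0 triv _)).
    by rewrite /K; move: (size W) W1 sW => [|[|[|n]]] //=; lia.
  move=> W' triv' sW'; rewrite (small _ triv'); first exact: derives_refl.
  by move: sW sW'; rewrite expn0; lia.
case: (leqP (size W) 1) => [/(small _ triv) ->|W1]; first exact: derives_refl.
apply: (derives_le _ (halve W (K * k.+1 * (size W).-1./2 ^ 2) triv _)).
  move: (size W) W1 {sW} => [//|m] m1 /=; have hm := half_leq (leqnn m).
  have : m./2.*2 <= m by rewrite -{2}(odd_double_half m) leq_addl.
  rewrite -addnn; move: m./2 => h hh; rewrite /K.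
  have e1 : h ^ 2 * 4 <= m ^ 2 by nia.
  have e2 : m <= m ^ 2 by nia.
  have e3 : m.+2 ^ 2 <= 9 * m ^ 2 by nia.
  have e4 : m.+1 <= 2 * m ^ 2 by nia.
  move: (h ^ 2) (m ^ 2) (m.+2 ^ 2) e1 e2 e3 e4 => a b c e1 e2 e3 e4.
  have f1 : K1 * m.+1 <= K1 * (2 * b) by rewrite leq_mul.
  have f2 : K2 * c <= K2 * (9 * b) by rewrite leq_mul.
  have f3 : (2 * K1 + 9 * K2) * k.+1 * (a * 4) <= (2 * K1 + 9 * K2) * k.+1 * b.
    by rewrite leq_mul.
  by lia.
move=> W' triv' sW'; apply: derives_le (IH W' triv' _); last first.
  by move: sW sW'; rewrite expnS; lia.
rewrite leq_mul // leq_exp2r //; lia.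
Qed.

(** Starting from one edge with boundary a a^-1, a derivation run backwards produces W a a^-1, up to
    signs; the pair, which kept the boundary nonempty, is removed at the end. *)
Lemma lysenok_disc : exists C, forall W,
  normal_closure lysenok W -> W <> [::] ->
  1 < size W /\ disc lysenok W (C * trunc_log 2 (size W) * size W ^ 2).
Proof.
have [K hK] := quasi_quadratic; have [K1 h1] := derives_disc.
have [K2 h2] := disc_unpair.
(* The 3 comes from t + 2 <= 3t, [K2] from the final unpairing and 4 from the initial edge and the
   sign flips; t >= 1 since no single letter acts trivially. *)
exists (3 * K * K1 + K2 + 4) => W nc W0.
have triv := normal_closure_acts_trivially nc.
have sW : 1 < size W.
  case: W W0 triv {nc} => [//|[x b] [|]] // _ triv.
  by case: (@acts_nontrivially_gen x).
split=> //; set n := size W in sW *; set t := trunc_log 2 n.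
have t1 : 0 < t by rewrite trunc_log_gt0.
have hW : derives rule (map fst W) [::] (K * t.+2 * n.-1 ^ 2).
  rewrite /n -(size_map fst W); apply: hK => //; rewrite size_map -/n.
  (* Since n < 2^(t+1), the level is k = t + 1, whence the factor [t.+2]. *)
  by have := trunc_log_ltn n (isT : 1 < 2); rewrite -/t => /ltnW /leqW.
pose l : letter gen := (ga, false).
have l0 : [:: l; letter_inv l] <> [::] by [].
have [+ _] := h1 _ _ _ hW _ 2 l0 => /(_ (disc_edge lysenok l)).
have := @rewrites_flips W (pos (map fst W)) (esym (fst_pos _)).
rewrite -/n => /(_ [::] [:: l; letter_inv l]) h /h /= {}h.
have {}h := h2 W [::] l _ _ h; rewrite !cats0 in h.
apply: disc_le (h W0); rewrite -/n.
have e1 : n.-1 ^ 2 <= n ^ 2 by rewrite leq_exp2r // leq_pred.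
have e2 : 4 <= n ^ 2 by rewrite (@leq_exp2r 2 n 2).
have e3 : 2 * n <= n ^ 2 by rewrite (expnS n 1) expn1 leq_mul.
move: (n.-1 ^ 2) (n ^ 2) e1 e2 e3 => a b e1 e2 e3.
have f1 : K1 * (K * t.+2 * a) <= K1 * (K * (3 * t) * b).
  by rewrite !leq_mul //; lia.
have f2 : b <= t * b by rewrite leq_pmull.
have f3 : K2 <= K2 * (t * b) by rewrite leq_pmulr // muln_gt0 t1; lia.
by lia.
Qed.

(** * Comparison with the real function x^2 log_2 x *)

Local Open Scope ring_scope.

Theorem theorem1p8 (R : realType) :
  exists C1 : R, 1 < C1 /\
    forall (j : 'I_3) (x : nat), (1 <= x)%N ->
      (dehn R lysenok j x <= (C1 * x%:R ^+ 2 * (ln x%:R / ln 2))%:E)%E.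
Proof.
(* The summand 2 ensures that the constant exceeds 1. *)
have [C hC] := lysenok_disc; exists (C%:R + 2); split.
  by apply: ltr_wpDl; rewrite ?ler0n ?ltr1n.
move=> j x x1; have ln2 : 0 < ln 2 :> R by rewrite ln_gt0 ?ltr1n.
have lnx : 0 <= ln x%:R :> R by rewrite ln_ge0 // ler1n.
have log0 : 0 <= ln x%:R / ln 2 :> R by rewrite divr_ge0 // ltW.
apply: ge_ereal_sup => _ [->|[W [nc W0 sW] <-]].
  by rewrite lee_fin mulr_ge0 ?log0 // mulr_ge0 ?exprn_ge0 ?addr_ge0 ?ler0n.
have [W1 /disc_diagram [Delta bW dD]] := hC W nc W0.
apply: (@le_trans _ _ ((num_cells j Delta)%:R%:E)).
  by apply: ereal_inf_lbound; exists Delta.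
rewrite lee_fin; set n := size W in sW W1 dD; set t := trunc_log 2 n in dD.
apply: (@le_trans _ _ ((C * t * n ^ 2)%N%:R)).
  by rewrite ler_nat; apply: leq_trans (num_cells_le _ _) dD.
(* Equivalent to 2^t <= x, which follows from 2^t <= n <= x. *)
have tx : t%:R <= ln x%:R / ln 2 :> R.
  rewrite ler_pdivlMr // mulr_natl -lnXn // ler_ln ?posrE ?exprn_gt0 ?ltr0n //.
  rewrite -natrX ler_nat; apply: leq_trans sW.
  by apply: trunc_logP => //; apply: ltnW.
apply: (@le_trans _ _ ((C * x ^ 2)%N%:R * (ln x%:R / ln 2))).
  by rewrite mulnAC natrM ler_pM ?ler0n // ler_nat leq_mul // leq_exp2r.
rewrite natrM natrX; apply: ler_wpM2r => //.
by rewrite ler_wpM2r ?exprn_ge0 ?ler0n // lerDl ler0n.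
Qed.
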